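(* Let $\mathcal{A}_d:Q\times Q\to G$ be a discrete connection $1$-form, with discrete horizontal lift $(\cdot,\cdot)^h_q$. The map $\alpha_{\mathcal{A}_d}:(Q\times Q)/G\to(S\times S)\oplus\tilde{G}$ defined by $$\alpha_{\mathcal{A}_d}([q_0,q_1]_G)=(\pi q_0,\pi q_1)\oplus[q_0,\mathcal{A}_d(q_0,q_1)]_G$$ is a well-defined isomorphism of bundles over $S$. Its inverse is given by $$\alpha_{\mathcal{A}_d}^{-1}\big((x_0,x_1)\oplus[q,g]_G\big)=\big[(e,g)\cdot(x_0,x_1)^h_q\big]_G$$ for any $q\in Q$ such that $\pi q=x_0$.
   Context: $Q$ is a smooth manifold with a free smooth left action $(g,q)\mapsto gq$ of a Lie group $G$ such that the projection $\pi:Q\to S=Q/G$ is a submersion; $e$ is the identity of $G$. $G$ acts on $Q\times Q$ diagonally, and $(Q\times Q)/G$ is a bundle over $S$ via $[q_0,q_1]_G\mapsto\pi(q_0)$; $G\times G$ acts on $Q\times Q$ componentwise, $(g,h)\cdot(q_0,q_1)=(gq_0,hq_1)$. $\tilde{G}=(Q\times G)/G$ is the associated bundle for the action $k(q,g)=(kq,kgk^{-1})$, with projection $[q,g]_G\mapsto\pi(q)$ to $S$. $(S\times S)\oplus\tilde{G}$ is the fiber product over $S$ of $S\times S\to S$, $(x_0,x_1)\mapsto x_0$, and $\tilde{G}\to S$; its elements are written $(x_0,x_1)\oplus[q,g]_G$ with $\pi(q)=x_0$. A discrete connection $1$-form is a (smooth) map $\mathcal{A}_d:Q\times Q\to G$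 such that $\mathcal{A}_d(gq_0,hq_1)=h\,\mathcal{A}_d(q_0,q_1)\,g^{-1}$ for all $g,h\in G$, $q_0,q_1\in Q$ (in particular $\mathcal{A}_d(gq_0,gq_1)=g\mathcal{A}_d(q_0,q_1)g^{-1}$) and $\mathcal{A}_d(q,gq)=g$ for all $q\in Q,\ g\in G$. For $(x_0,x_1)\in S\times S$ and $q\in\pi^{-1}(x_0)$, the discrete horizontal lift $(x_0,x_1)^h_q\in Q\times Q$ is the unique element $(q,q')$ with $\pi(q')=x_1$ and $\mathcal{A}_d(q,q')=e$. *)

(* Defs.v *)
From HB Require Import structures.
From mathcomp Require Import all_boot all_order all_algebra.
From mathcomp Require Import all_classical all_reals all_analysis.

Set Implicit Arguments.
Unset Strict Implicit.
Unset Printing Implicit Defensive.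

Import Order.TTheory GRing.Theory Num.Theory numFieldNormedType.Exports.

Local Open Scope classical_set_scope.
Local Open Scope ring_scope.

Section Smooth.
Context {R : realType}.

(* On an open U of R^m: f is of class C^(k+1) iff it is differentiable on U
   and each of its directional derivatives is of class C^k on U. *)
Fixpoint Ck (k : nat) (m n : nat) (U : set 'rV[R]_m)
    (f : 'rV[R]_m -> 'rV[R]_n) : Prop :=
  if k is k'.+1 then
    (forall x, U x -> differentiable f x) /\
    (forall v : 'rV[R]_m, Ck k' U (fun x => 'D_v f x))
  else forall x, U x -> {for x, continuous f}.

Definition Cinfty (m n : nat) (U : set 'rV[R]_m)
    (f : 'rV[R]_m -> 'rV[R]_n) : Prop := forall k, Ck k U f.

(* The chart is cmap restricted to cdom; cinv matters only on cmap @` cdom. *)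
Record chart (n : nat) (M : Type) := Chart {
  cdom : set M ;
  cmap : M -> 'rV[R]_n ;
  cinv : 'rV[R]_n -> M }.

Definition is_chart (n : nat) (M : topologicalType) (c : chart n M) : Prop :=
  [/\ open (cdom c),
      open (cmap c @` cdom c),
      forall x, cdom c x -> cinv c (cmap c x) = x,
      forall x, cdom c x -> {for x, continuous (cmap c)} &
      forall y, (cmap c @` cdom c) y -> {for y, continuous (cinv c)}].

Definition atlas (n : nat) (M : Type) := set (chart n M).

Definition is_manifold (n : nat) (M : topologicalType) (aM : atlas n M) : Prop :=
  [/\ hausdorff_space M,
      @second_countable M,
      forall c, aM c -> is_chart c,
      forall x : M, exists2 c, aM c & cdom c x &
      forall c d, aM c -> aM d ->
        Cinfty (cmap c @` (cdom c `&` cdom d)) (cmap d \o cinv c)].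

Definition prod_chart (m n : nat) (M N : Type) (c : chart m M) (d : chart n N) :
    chart (m + n) (M * N) :=
  Chart (cdom c `*` cdom d)
        (fun p => row_mx (cmap c p.1) (cmap d p.2))
        (fun z => (cinv c (lsubmx z), cinv d (rsubmx z))).

Definition prod_atlas (m n : nat) (M N : Type)
    (aM : atlas m M) (aN : atlas n N) : atlas (m + n) (M * N) :=
  [set e | exists c d, [/\ aM c, aN d & e = prod_chart c d]].

Definition coord_rep (m n : nat) (M N : Type) (c : chart m M) (d : chart n N)
    (f : M -> N) : 'rV[R]_m -> 'rV[R]_n := cmap d \o f \o cinv c.

Definition smooth_map (m n : nat) (M N : topologicalType)
    (aM : atlas m M) (aN : atlas n N) (f : M -> N) : Prop :=
  continuous f /\
  forall c d, aM c -> aN d ->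
    Cinfty (cmap c @` (cdom c `&` f @^-1` cdom d)) (coord_rep c d f).

Definition submersion (m n : nat) (M N : topologicalType)
    (aM : atlas m M) (aN : atlas n N) (f : M -> N) : Prop :=
  smooth_map aM aN f /\
  forall c d x, aM c -> aN d -> cdom c x -> cdom d (f x) ->
    forall w, exists v, 'd (coord_rep c d f) (cmap c x) v = w.

Definition immersion (m n : nat) (M N : topologicalType)
    (aM : atlas m M) (aN : atlas n N) (f : M -> N) : Prop :=
  smooth_map aM aN f /\
  forall c d x, aM c -> aN d -> cdom c x -> cdom d (f x) ->
    injective ('d (coord_rep c d f) (cmap c x)).

(* set_type A carries the subspace topology, so that the inclusion set_val is
   an embedding as soon as it is an immersion. *)
Definition embedded_submanifold (m n : nat) (N : topologicalType)
    (aN : atlas n N) (A : set N) (aA : atlas m (set_type A)) : Prop :=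
  is_manifold aA /\ immersion aA aN (@set_val N A).

End Smooth.

Arguments chart : clear implicits.
Arguments atlas : clear implicits.

(* The carrier of a Lie group: a topology and a group law on the same type,
   without compatibility (which is part of is_lie_group). *)
#[short(type="groupTopologicalType")]
HB.structure Definition GroupTopological := {G of Topological G & Group G}.

Definition is_lie_group (R : realType) (n : nat) (G : groupTopologicalType)
    (aG : atlas R n G) : Prop :=
  [/\ is_manifold aG,
      smooth_map (prod_atlas aG aG) aG (fun p : G * G => (p.1 * p.2)%g) &
      smooth_map aG aG (fun g : G => g^-1%g)].

Record left_action (G : groupType) (X : Type) := LeftAction {
  lact :> G -> X -> X ;
  lact1 : forall x, lact 1%g x = x ;
  lactM : forall g h x, lact (g * h)%g x = lact g (lact h x) }.

Definition free_action (G : groupType) (X : Type) (a : left_action G X) : Prop :=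
  forall g x, a g x = x -> g = 1%g.

Definition smooth_action (R : realType) (m n : nat) (G : groupTopologicalType)
    (X : topologicalType) (aG : atlas R m G) (aX : atlas R n X)
    (a : left_action G X) : Prop :=
  smooth_map (prod_atlas aG aX) aX (fun p : G * X => a p.1 p.2).

Section OrbitSpace.
Local Open Scope quotient_scope.
Context {G : groupType} {X : topologicalType} (a : left_action G X).

Definition orbit_rel (x y : X) : bool := `[< exists g, y = a g x >].

Lemma orbit_rel_refl : reflexive orbit_rel.
Proof. by move=> x; apply/asboolP; exists 1%g; rewrite lact1. Qed.

Lemma orbit_rel_sym : symmetric orbit_rel.
Proof.
suff H x y : orbit_rel x y -> orbit_rel y x.
  by move=> x y; apply/idP/idP; exact: H.
move=> /asboolP[g ->]; apply/asboolP; exists g^-1%g.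
by rewrite -lactM mulVg lact1.
Qed.

Lemma orbit_rel_trans : transitive orbit_rel.
Proof.
move=> y x z /asboolP[g ->] /asboolP[h ->]; apply/asboolP.
by exists (h * g)%g; rewrite lactM.
Qed.

Canonical orbit_equiv :=
  EquivRel orbit_rel orbit_rel_refl orbit_rel_sym orbit_rel_trans.

Definition orbit_space : topologicalType :=
  quotient_topology {eq_quot orbit_equiv}.

Definition orbit_proj (x : X) : orbit_space := \pi_{eq_quot orbit_equiv} x.

Definition orbit_repr (z : orbit_space) : X := repr (z : {eq_quot orbit_equiv}).

Lemma orbit_reprK z : orbit_proj (orbit_repr z) = z.
Proof. exact: reprK. Qed.

Lemma orbit_projP x y : orbit_proj x = orbit_proj y <-> exists g, y = a g x.
Proof.
split=> [/eqmodP/asboolP //|xy].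
by apply/eqmodP; apply/asboolP.
Qed.

Lemma orbit_reprP x : exists g, x = a g (orbit_repr (orbit_proj x)).
Proof. by apply/orbit_projP; rewrite orbit_reprK. Qed.

End OrbitSpace.

(* At most one smooth structure on X / G makes the projection a submersion. *)
Definition quotient_manifold (R : realType) (m n : nat) (G : groupType)
    (X : topologicalType) (a : left_action G X)
    (aX : atlas R m X) (aS : atlas R n (orbit_space a)) : Prop :=
  is_manifold aS /\ submersion aX aS (orbit_proj a).

Section Actions.
Context {G : groupTopologicalType} {Q : topologicalType} (a : left_action G Q).

Definition diag_act (g : G) (p : Q * Q) : Q * Q := (a g p.1, a g p.2).

Lemma diag_act1 p : diag_act 1%g p = p.
Proof. by case: p => q0 q1; rewrite /diag_act !lact1. Qed.

Lemma diag_actM g h p : diag_act (g * h)%g p = diag_act g (diag_act h p).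
Proof. by rewrite /diag_act !lactM. Qed.

Definition diag_action := LeftAction diag_act1 diag_actM.

Definition comp_act (gh : G * G) (p : Q * Q) : Q * Q :=
  (a gh.1 p.1, a gh.2 p.2).

Definition assoc_act (k : G) (p : Q * G) : Q * G :=
  (a k p.1, (k * p.2 * k^-1)%g).

Lemma assoc_act1 p : assoc_act 1%g p = p.
Proof. by case: p => q g; rewrite /assoc_act lact1 mul1g invg1 mulg1. Qed.

Lemma assoc_actM g h p : assoc_act (g * h)%g p = assoc_act g (assoc_act h p).
Proof. by rewrite /assoc_act lactM invgM /= !mulgA. Qed.

Definition assoc_action := LeftAction assoc_act1 assoc_actM.

Definition base := orbit_space a.
Definition pair_quot := orbit_space diag_action.
Definition assoc_bundle := orbit_space assoc_action.

Definition pr_base : Q -> base := orbit_proj a.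
Definition pair_class (q0 q1 : Q) : pair_quot := orbit_proj diag_action (q0, q1).
Definition assoc_class (q : Q) (g : G) : assoc_bundle :=
  orbit_proj assoc_action (q, g).

Definition pr_pair (z : pair_quot) : base := pr_base (orbit_repr z).1.
Definition pr_assoc (z : assoc_bundle) : base := pr_base (orbit_repr z).1.

Lemma pr_pairE q0 q1 : pr_pair (pair_class q0 q1) = pr_base q0.
Proof.
have [g /(congr1 fst)/= q0E] := orbit_reprP diag_action (q0, q1).
by apply/orbit_projP; exists g.
Qed.

Lemma pr_assocE q g : pr_assoc (assoc_class q g) = pr_base q.
Proof.
have [k /(congr1 fst)/= qE] := orbit_reprP assoc_action (q, g).
by apply/orbit_projP; exists k.
Qed.

Definition fiber_sum : set ((base * base) * assoc_bundle) :=
  [set p | p.1.1 = pr_assoc p.2].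

Definition pr_fiber (z : set_type fiber_sum) : base := (set_val z).1.1.

Lemma oplus_subproof (x0 x1 : base) (q : Q) (g : G) : pr_base q = x0 ->
  ((x0, x1), assoc_class q g) \in fiber_sum.
Proof. by move=> qx0; apply/mem_set; rewrite /fiber_sum /= pr_assocE. Qed.

(* (x0, x1) (+) [q, g]_G *)
Definition oplus (x0 x1 : base) (q : Q) (g : G) (qx0 : pr_base q = x0) :
    set_type fiber_sum :=
  exist _ ((x0, x1), assoc_class q g) (oplus_subproof x1 g qx0).

Definition discrete_connection (R : realType) (nQ nG : nat)
    (aQ : atlas R nQ Q) (aG : atlas R nG G) (A : Q * Q -> G) : Prop :=
  [/\ smooth_map (prod_atlas aQ aQ) aG A,
      forall g h q0 q1, A (a g q0, a h q1) = (h * A (q0, q1) * g^-1)%g &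
      forall q g, A (q, a g q) = g].

Definition is_hlift (A : Q * Q -> G) (x0 x1 : base) (q : Q) : set (Q * Q) :=
  [set r | [/\ r.1 = q, pr_base r.1 = x0, pr_base r.2 = x1 & A r = 1%g]].

(* The default (q, q) is never used when A is a discrete connection and
   pr_base q = x0: see hliftP. *)
Definition hlift (A : Q * Q -> G) (x0 x1 : base) (q : Q) : Q * Q :=
  xget (q, q) (is_hlift A x0 x1 q).

Lemma hliftP (R : realType) (nQ nG : nat) (aQ : atlas R nQ Q)
    (aG : atlas R nG G) (A : Q * Q -> G) (x0 x1 : base) (q : Q) :
  discrete_connection aQ aG A -> pr_base q = x0 ->
  is_hlift A x0 x1 q (hlift A x0 x1 q) /\
  (forall r, is_hlift A x0 x1 q r -> r = hlift A x0 x1 q).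
Proof.
move=> [_ Aeq Aid] qx0.
have AM h p p' : A (p, a h p') = (h * A (p, p'))%g.
  by rewrite -{1}(lact1 a p) Aeq invg1 mulg1.
have Hex : is_hlift A x0 x1 q (hlift A x0 x1 q).
  pose q1 := orbit_repr x1; apply: (@xgetPex _ _ (is_hlift A x0 x1 q)).
  exists (q, a (A (q, q1))^-1%g q1); split => //=; last by rewrite AM mulVg.
  rewrite -[RHS](orbit_reprK x1); apply/orbit_projP; exists (A (q, q1)).
  by rewrite -lactM mulgV lact1.
split=> // -[r0 r1] [/= -> _ r1x1 Ar].
case: Hex; case: (hlift _ _ _ _) => [s0 s1] /= -> _ s1x1 As.
have /orbit_projP[h E] : pr_base r1 = pr_base s1 by rewrite r1x1.
by move: As; rewrite E AM Ar mulg1 => ->; rewrite lact1.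
Qed.

End Actions.

Arguments fiber_sum {G Q} a.
Arguments pr_pair {G Q} a z.
Arguments pr_fiber {G Q} a z.
Arguments oplus {G Q} a x0 x1 q g qx0.
Arguments hlift {G Q} a A x0 x1 q.

(* An isomorphism alpha of bundles over B, with inverse beta; pM and pN are the
   bundle projections. *)
Definition bundle_isomorphism (R : realType) (m n : nat) (M N : topologicalType)
    (B : Type) (aM : atlas R m M) (aN : atlas R n N) (pM : M -> B) (pN : N -> B)
    (alpha : M -> N) (beta : N -> M) : Prop :=
  [/\ smooth_map aM aN alpha, smooth_map aN aM beta,
      cancel alpha beta, cancel beta alpha & pN \o alpha = pM].

(* Main.v *)
(* The bijection is algebra: bundle_inv maps (x0, x1) (+) [q, g] to
   [q, g A(q, q1)^-1 q1] for any q1 over x1, and A(q, q1)^-1 q1 is the second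
   entry of the horizontal lift. For smoothness, a map out of an orbit space is
   composed with a smooth local section of the projection, and a map into the
   fiber product is recovered from its composite with the inclusion.
   Local sections of a submersion come from Banach's fixed point theorem, which
   gives a continuous section only; its smoothness follows from Cnear_lift, by
   which a continuous f is smooth as soon as h o f is, when h is smooth with
   injective differential. The same lemma handles the inclusion. *)

Require Import Defs.
From HB Require Import structures.
From mathcomp Require Import all_boot all_order all_algebra.
From mathcomp Require Import all_classical all_reals all_analysis.
From mathcomp Require Import ring lra.

Set Implicit Arguments.
Unset Strict Implicit.
Unset Printing Implicit Defensive.

Import Order.TTheory GRing.Theory Num.Theory numFieldNormedType.Exports.

Local Open Scope classical_set_scope.
Local Open Scope ring_scope.

(** Both maps are defined through [orbit_repr], a choice of representatives with no continuity.
    Hence [bundle_mapE] and [bundle_invE] must first free their values from the choice; only then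
    can representatives that vary smoothly be substituted. The horizontal lift is also a bare
    choice, so the inverse is built from [A] and the action alone, and the lift enters only in the
    final comparison. The regularity argument is a bootstrap. If [h] has injective differential, the
    chain rule can be solved for the derivative of [f]: it is a smooth expression in [f] itself and
    in derivatives of [h] and [h \o f]. Thus each order of smoothness of [f] yields the next one,
    starting from continuity. For a local right inverse [t] of [g], take [h = g], where [g \o t] is
    the identity near the point; for the fiber product, take [h] to be the inclusion in charts. *)

(** * Differentiability in epsilon form *)

Lemma differentiable_leP {R : realType} (V W : normedModType R)
    (f : V -> W) (x : V) (L : {linear V -> W}) :
  continuous L ->
  (forall e, 0 < e -> \forall h \near (0 : V), `|f (h + x) - f x - L h| <= e * `|h|) ->
  differentiable f x /\ 'd f x = L :> (V -> W).
Proof.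
move=> Lc fL.
have E : f \o shift x = cst (f x) + L +o_ 0 id.
  apply/eqaddoP => e e0; near=> h.
  have -> : (f \o shift x - (cst (f x) + L)) h = f (h + x) - f x - L h.
    by rewrite !fctE opprD addrA.
  by near: h; apply: fL.
have dE := diff_unique Lc E; split=> //.
by apply/diff_locallyP; rewrite dE.
Unshelve. all: by end_near. Qed.

Lemma differentiable_le {R : realType} (V W : normedModType R)
    (f : V -> W) (x : V) : differentiable f x ->
  forall e, 0 < e ->
    \forall h \near (0 : V), `|f (h + x) - f x - 'd f x h| <= e * `|h|.
Proof.
move=> /diff_locally /eqaddoP H e e0; have := H e e0.
by apply: filterS => h; rewrite !fctE opprD addrA.
Qed.

Lemma near_eq_differentiable {R : realType} (V W : normedModType R)
    (f g : V -> W) (x : V) :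
  (\near x, f x = g x) -> differentiable f x -> differentiable g x.
Proof.
move=> fg df; apply: (proj1 (@differentiable_leP _ _ _ g x ('d f x) _ _)).
  exact: diff_continuous.
move=> e e0; rewrite -(nbhs_singleton fg).
have fg0 : \forall h \near (0 : V), f (h + x) = g (h + x).
  have : (fun h : V => h + x) @ 0 --> x.
    by rewrite -{2}(add0r x); apply: cvgD; [exact: cvg_id|exact: cvg_cst].
  by move=> /(_ _ fg).
near=> h.
have <- : f (h + x) = g (h + x) by near: h.
by near: h; apply: differentiable_le.
Unshelve. all: by end_near. Qed.

(* Since the condition is imposed near x, it is stable under composition and
   insensitive to the junk derivatives of f away from x. *)
Fixpoint Cnear {R : realType} (k : nat) (V W : normedModType R) (f : V -> W)
    (x : V) : Prop :=
  if k is k'.+1 then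
    \forall z \near x, differentiable f z /\ (forall v, Cnear k' ('D_v f) z)
  else \forall z \near x, {for z, continuous f}.

(** * Calculus of C^k maps near a point *)

Section Cnear_theory.
Context {R : realType}.
Implicit Types (V W : normedModType R) (k : nat).

Lemma Cnear_near k V W (f : V -> W) x :
  Cnear k f x -> \forall z \near x, Cnear k f z.
Proof. by case: k => [|k] /= /near_join. Qed.

(** By [near_join], agreement near [x] is agreement near every point close to [x], so it passes to
    directional derivatives and the induction goes through. *)
Lemma Cnear_eq k V W (f g : V -> W) x :
  (\near x, f x = g x) -> Cnear k f x -> Cnear k g x.
Proof.
elim: k f g x => [|k IH] f g x fg /=; have {}fg := near_join fg.
  move=> fc; near=> z.
  have fgz : \near z, f z = g z by near: z.
  have : {for z, continuous f} by near: z.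
  rewrite /prop_for /continuous_at -(nbhs_singleton fgz); apply: cvg_trans.
  exact: near_eq_cvg.
move=> fc; near=> z.
have fgz : \near z, f z = g z by near: z.
have [fd fv] : differentiable f z /\ (forall v, Cnear k ('D_v f) z) by near: z.
split; first exact: near_eq_differentiable fd.
move=> v; apply: IH (fv v); have := near_join fgz.
by apply: filterS => y; exact: near_eq_derive.
Unshelve. all: by end_near. Qed.

Lemma CnearW k V W (f : V -> W) x : Cnear k.+1 f x -> Cnear k f x.
Proof.
elim: k f x => [|k IH] f x /=; apply: filterS => z [fd fv].
  exact: differentiable_continuous.
by split=> // v; exact: IH (fv v).
Qed.

Lemma Cnear_cst k V W (c : W) (x : V) : Cnear k (cst c) x.
Proof.
elim: k c x => [|k IH] c x /=; apply: nearW => z; first exact: cvg_cst.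
split=> [|v]; first exact: differentiable_cst.
rewrite [X in Cnear _ X _](_ : _ = cst 0) //; apply/funext => y.
exact: derive_cst.
Qed.

Lemma Cnear_id k V (x : V) : Cnear k id x.
Proof.
case: k => [|k] /=; apply: nearW => z; first exact: cvg_id.
split=> [|v]; first exact: ex_diff.
rewrite [X in Cnear _ X _](_ : _ = cst v); first exact: Cnear_cst.
by apply/funext => y; exact: derive_id.
Qed.

Lemma CnearD k V W (f g : V -> W) x :
  Cnear k f x -> Cnear k g x -> Cnear k (f + g) x.
Proof.
elim: k f g x => [|k IH] f g x /= fc gc; near=> z.
  by apply: continuousD; near: z.
have [fd fv] : differentiable f z /\ (forall v, Cnear k ('D_v f) z) by near: z.
have [gd gv] : differentiable g z /\ (forall v, Cnear k ('D_v g) z) by near: z.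
split=> [|v]; first exact: differentiableD.
apply: Cnear_eq (IH _ _ _ (fv v) (gv v)).
have : \forall y \near z, differentiable f y /\ differentiable g y.
  near: z; apply/near_join; near=> z; split.
    by have /= [] := near fc z.
  by have /= [] := near gc z.
apply: filterS => y [fy gy]; rewrite deriveD //; exact: diff_derivable.
Unshelve. all: by end_near. Qed.

Lemma Cnear_linear k V W W' (L : {linear W -> W'}) (f : V -> W) x :
  continuous L -> Cnear k f x -> Cnear k (L \o f) x.
Proof.
move=> Lc; elim: k f x => [|k IH] f x /= fc; near=> z.
  by apply: continuous_comp; [near: z|exact: Lc].
have [fd fv] : differentiable f z /\ (forall v, Cnear k ('D_v f) z) by near: z.
split=> [|v].
  by apply: differentiable_comp => //; exact: linear_differentiable.
apply: Cnear_eq (IH _ _ (fv v)).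
have : \forall y \near z, differentiable f y.
  by near: z; apply/near_join; near=> z; have /= [] := near fc z.
apply: filterS => y fy.
have Ld : differentiable L (f y) by exact: linear_differentiable.
rewrite (@deriveE _ _ _ (L \o f)); last exact: differentiable_comp.
by rewrite diff_comp //= diff_lin // deriveE.
Unshelve. all: by end_near. Qed.

Lemma CnearM k V (f g : V -> R) x :
  Cnear k f x -> Cnear k g x -> Cnear k (f * g) x.
Proof.
elim: k f g x => [|k IH] f g x fc gc.
  rewrite /=; near=> z.
  by apply: continuousM; near: z.
have fk := Cnear_near (CnearW fc); have gk := Cnear_near (CnearW gc).
move: (fc) (gc) => /= fc' gc'; near=> z.
have [fd fv] : differentiable f z /\ (forall v, Cnear k ('D_v f) z) by near: z.
have [gd gv] : differentiable g z /\ (forall v, Cnear k ('D_v g) z) by near: z.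
split=> [|v]; first exact: differentiableM.
apply: (@Cnear_eq _ _ _ (f * 'D_v g + g * 'D_v f)); last first.
  by apply: CnearD; apply: IH => //; near: z.
have : \forall y \near z, differentiable f y /\ differentiable g y.
  near: z; apply/near_join; near=> z; split.
    by have /= [] := near fc' z.
  by have /= [] := near gc' z.
apply: filterS => y [fy gy]; rewrite deriveM //; exact: diff_derivable.
Unshelve. all: by end_near. Qed.

Lemma CnearV k V (f : V -> R) x :
  f x != 0 -> Cnear k f x -> Cnear k (fun z => (f z)^-1) x.
Proof.
elim: k f x => [|k IH] f x f0 fc.
  rewrite /=; near=> z.
  apply: continuousV; last by near: z.
  near: z.
  have fx : {for x, continuous f} := nbhs_singleton fc.
  by have := fx _ (open_nbhs_nbhs (conj (@open_neq _ (0 : R)) f0)).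
have fk := Cnear_near (CnearW fc).
move: (fc) => /= fc'.
have fx : {for x, continuous f}.
  by apply: differentiable_continuous; case: (nbhs_singleton fc').
have fn0 : \forall z \near x, f z != 0.
  by have := fx _ (open_nbhs_nbhs (conj (@open_neq _ (0 : R)) f0)).
near=> z.
have [fd fv] : differentiable f z /\ (forall v, Cnear k ('D_v f) z) by near: z.
have fz0 : f z != 0 by near: z.
split=> [|v]; first exact: differentiableV.
pose g y := (f y)^-1.
have gk : Cnear k g z by apply: IH => //; near: z.
(* The derivative of the inverse is written with [g] itself, so that the induction hypothesis [gk]
   covers it. *)
apply: (@Cnear_eq _ _ _ (cst (- 1) * (g * g * 'D_v f))); last first.
  by do !apply: CnearM => //; exact: Cnear_cst.
have : \forall y \near z, differentiable f y /\ f y != 0.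
  near: z; apply/near_join; near=> z; split.
    by have /= [] := near fc' z.
  by near: z.
apply: filterS => y [fy y0]; rewrite deriveV //; last exact: diff_derivable.
by rewrite !fctE /g /cst mulN1r -mulNr -expr2 exprVn /GRing.scale.
Unshelve. all: by end_near. Qed.

Lemma Cnear_sum k V W (I : Type) (r : seq I) (P : pred I) (F : I -> V -> W) x :
  (forall i, P i -> Cnear k (F i) x) ->
  Cnear k (fun z => \sum_(i <- r | P i) F i z) x.
Proof.
move=> H; rewrite (_ : (fun _ => _) = \sum_(i <- r | P i) F i); last first.
  by apply/funext => z; rewrite fct_sumE.
elim/big_ind: _ => //; first exact: Cnear_cst.
by move=> f g fc gc; apply: CnearD.
Qed.

Lemma Cnear_prod k V (I : Type) (r : seq I) (P : pred I) (F : I -> V -> R) x :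
  (forall i, P i -> Cnear k (F i) x) ->
  Cnear k (fun z => \prod_(i <- r | P i) F i z) x.
Proof.
move=> H; rewrite (_ : (fun _ => _) = \prod_(i <- r | P i) F i); last first.
  by apply/funext => z; rewrite fct_prodE.
elim/big_ind: _ => //; first exact: Cnear_cst.
by move=> f g fc gc; apply: CnearM.
Qed.

End Cnear_theory.

(** * Matrix-valued maps, inverse matrices and composition *)

Section Cnear_matrix.
Context {R : realType}.
Implicit Types (V W : normedModType R) (k : nat).

Lemma linear_mx_sum m n W (L : {linear 'M[R]_(m, n) -> W}) (B : 'M[R]_(m, n)) :
  L B = \sum_(i < m) \sum_(j < n) B i j *: L (delta_mx i j).
Proof.
rewrite {1}(matrix_sum_delta B) raddf_sum; apply: eq_bigr => i _.
by rewrite raddf_sum; apply: eq_bigr => j _; exact: (linearZ_LR L).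
Qed.

Lemma mx_linear_continuous m n W (L : {linear 'M[R]_(m, n) -> W}) :
  continuous L.
Proof.
move=> A; rewrite (funext (linear_mx_sum L)).
have sum_cont (T : topologicalType) (W' : normedModType R) (p : nat)
    (F : 'I_p -> T -> W') (t : T) :
    (forall i, {for t, continuous (F i)}) ->
    {for t, continuous (fun z => \sum_(i < p) F i z)}.
  move=> Fc; rewrite (_ : (fun _ => _) = \sum_(i < p) F i); last first.
    by apply/funext => z; rewrite fct_sumE.
  elim/big_ind: _ => //; first exact: cvg_cst.
  by move=> f g fc gc; apply: continuousD.
apply: (sum_cont) => i; apply: (sum_cont) => j.
apply: (@continuous_comp _ _ _ (fun B : 'M[R]_(m, n) => B i j : R)
  ( *:%R^~ (L (delta_mx i j)))).
  exact: coord_continuous.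
exact: scalel_continuous.
Qed.

Lemma Cnear_mx_linear k V m n W (L : {linear 'M[R]_(m, n) -> W})
    (F : V -> 'M[R]_(m, n)) x :
  Cnear k F x -> Cnear k (L \o F) x.
Proof. exact/Cnear_linear/mx_linear_continuous. Qed.

Lemma Cnear_entry k V m n (F : V -> 'M[R]_(m, n)) x i j :
  Cnear k F x -> Cnear k (fun z => F z i j : R) x.
Proof.
pose e (A : 'M[R]_(m, n)) : R := A i j.
have el : linear e by move=> a A B; rewrite /e !mxE.
pose eL : {linear 'M[R]_(m, n) -> R} :=
  HB.pack e (GRing.isLinear.Build _ _ _ _ _ el).
exact: (@Cnear_mx_linear _ _ _ _ _ eL).
Qed.

Lemma Cnear_mx k V m n (F : V -> 'M[R]_(m, n)) x :
  (forall i j, Cnear k (fun z => F z i j : R) x) -> Cnear k F x.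
Proof.
move=> FC; rewrite (_ : F = fun z =>
    \sum_(i < m) \sum_(j < n) (F z i j : R) *: delta_mx i j); last first.
  by apply/funext => z; rewrite -matrix_sum_delta.
apply: Cnear_sum => i _; apply: Cnear_sum => j _.
pose s (r : R) := r *: delta_mx i j : 'M[R]_(m, n).
have sl : linear s by move=> a b c; rewrite /s scalerDl scalerA.
pose sL : {linear R -> 'M[R]_(m, n)} :=
  HB.pack s (GRing.isLinear.Build _ _ _ _ _ sl).
by apply: (@Cnear_linear _ _ _ _ _ sL (fun z => F z i j)) => //;
  exact: scalel_continuous.
Qed.

Lemma Cnear_mulmx k V m n p (F : V -> 'M[R]_(m, n)) (H : V -> 'M[R]_(n, p)) x :
  Cnear k F x -> Cnear k H x -> Cnear k (fun z => F z *m H z) x.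
Proof.
move=> FC HC; apply: Cnear_mx => i j.
rewrite [X in Cnear _ X _](_ : _ =
    fun z => \sum_l (fun z => F z i l : R) z * (fun z => H z l j : R) z); last first.
  by apply/funext => z; rewrite mxE.
by apply: Cnear_sum => l _; apply: CnearM; exact: Cnear_entry.
Qed.

Lemma Cnear_det k V n (F : V -> 'M[R]_n) x :
  Cnear k F x -> Cnear k (fun z => \det (F z)) x.
Proof.
move=> FC; apply: Cnear_sum => s _; apply: CnearM; first exact: Cnear_cst.
by apply: Cnear_prod => i _; exact: Cnear_entry.
Qed.

Lemma Cnear_continuous k V W (f : V -> W) x :
  Cnear k f x -> \forall z \near x, {for z, continuous f}.
Proof.
case: k => [//|k] /=; apply: filterS => z [fd _].
exact: differentiable_continuous.
Qed.

Lemma near_unitmx k V n (F : V -> 'M[R]_n) x :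
  Cnear k F x -> F x \in unitmx -> \forall z \near x, F z \in unitmx.
Proof.
move=> FC; rewrite unitmxE unitfE => Fx.
have dc := nbhs_singleton (Cnear_continuous (Cnear_det FC)).
have d0 : \forall z \near x, \det (F z) != 0.
  exact: dc _ (open_nbhs_nbhs (conj (@open_neq _ (0 : R)) Fx)).
by apply: filterS d0 => z dz; rewrite unitmxE unitfE.
Qed.

(** Cramer's rule: as long as the determinant is nonzero, the inverse is the adjugate divided by the
    determinant, and both are polynomial in the entries. *)
Lemma Cnear_invmx k V n (F : V -> 'M[R]_n) x :
  F x \in unitmx -> Cnear k F x -> Cnear k (fun z => invmx (F z)) x.
Proof.
move=> Fx FC; have Fu := near_unitmx FC Fx.
apply: (@Cnear_eq _ _ _ _ (fun z => (\det (F z))^-1 *: \adj (F z))).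
  by apply: filterS Fu => z Fz; rewrite /invmx Fz.
apply: Cnear_mx => i j; rewrite [X in Cnear _ X _](_ : _ =
    (fun z => (\det (F z))^-1) *
    (cst ((-1) ^+ (j + i)) * (fun z => \det (row' j (col' i (F z)))))); last first.
  by apply/funext => z; rewrite !mxE.
apply: CnearM.
  by apply: CnearV; [rewrite -unitfE -unitmxE|exact: Cnear_det].
apply: CnearM; first exact: Cnear_cst.
apply: Cnear_det; apply: Cnear_mx => i' j'.
rewrite [X in Cnear _ X _](_ : _ = fun z => F z (lift j i') (lift i j')).
  exact: Cnear_entry.
by apply/funext => z; rewrite !mxE.
Qed.

(** In the chain rule [g] is derived in the direction ['D_v f z], which moves with [z]. Expanding
    along the basis leaves fixed directions, so each term is a product to which an induction on the
    order applies. *)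
Lemma derive_comp_rV V n W (f : V -> 'rV[R]_n) (g : 'rV[R]_n -> W) z v :
  differentiable f z -> differentiable g (f z) ->
  'D_v (g \o f) z =
  \sum_(j < n) ('D_v f z 0 j : R) *: 'D_(delta_mx 0 j) g (f z).
Proof.
move=> fd gd; rewrite deriveE; last exact: differentiable_comp.
rewrite diff_comp //= -(deriveE v fd) linear_mx_sum big_ord1.
by apply: eq_bigr => j _; rewrite (deriveE (delta_mx 0 j) gd).
Qed.

(** Matrix values of [g] are allowed because the lifting argument composes [f] with a Jacobian. *)
Lemma Cnear_comp k V n p q (f : V -> 'rV[R]_n) (g : 'rV[R]_n -> 'M[R]_(p, q)) x :
  Cnear k f x -> Cnear k g (f x) -> Cnear k (g \o f) x.
Proof.
elim: k f g x => [|k IH] f g x fc gc.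
  have fx := nbhs_singleton (Cnear_continuous fc).
  rewrite /=; near=> z; apply: continuous_comp; near: z => //.
  exact: (fx _ gc).
have fx := nbhs_singleton (Cnear_continuous fc).
have gf : \forall z \near x, Cnear k.+1 g (f z) := fx _ (Cnear_near gc).
have fk := Cnear_near fc.
rewrite /=; near=> z.
have fz : Cnear k.+1 f z by near: z.
have gz : Cnear k.+1 g (f z) by near: z.
have [fd fv] := nbhs_singleton fz; have [gd gv] := nbhs_singleton gz.
split; first exact: differentiable_comp.
move=> v; apply: (@Cnear_eq _ _ _ _ (fun y => \sum_(j < n)
    ('D_v f y 0 j : R) *: 'D_(delta_mx 0 j) g (f y))).
  have fz' := nbhs_singleton (Cnear_continuous fz).
  have gfd : \forall y \near z, differentiable g (f y).
    have gn : \forall w \near f z, differentiable g w.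
      by apply: filterS gz => y [].
    exact: (fz' _ gn).
  have fd' : \forall y \near z, differentiable f y by apply: filterS fz => y [].
  by near=> y; rewrite derive_comp_rV //; near: y.
apply: Cnear_sum => j _; apply: Cnear_mx => i l.
rewrite [X in Cnear _ X _](_ : _ = (fun y => 'D_v f y 0 j : R) *
    (fun y => ('D_(delta_mx 0 j) g \o f) y i l : R)); last first.
  by apply/funext => y; rewrite mxE.
apply: CnearM; apply: Cnear_entry; first exact: fv.
by apply: IH; [exact: CnearW|exact: gv].
Unshelve. all: by end_near. Qed.

(** An open [U] is a neighbourhood of each of its points, so conditions on [U] and conditions near
    its points agree at every order. *)
Lemma CkP k m n (U : set 'rV[R]_m) (f : 'rV[R]_m -> 'rV[R]_n) : open U ->
  Ck k U f <-> (forall x, U x -> Cnear k f x).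
Proof.
move=> oU; elim: k f => [|k IH] f /=.
  split=> fU x Ux; last exact: nbhs_singleton (fU x Ux).
  by apply: filterS (open_nbhs_nbhs (conj oU Ux)) => z; exact: fU.
split=> [[fd fv] x Ux|fU].
  apply: filterS (open_nbhs_nbhs (conj oU Ux)) => z Uz; split; first exact: fd.
  by move=> v; have /IH := fv v; exact.
split=> [x Ux|v]; first by have [] := nbhs_singleton (fU x Ux).
by apply/IH => x Ux; have [_] := nbhs_singleton (fU x Ux).
Qed.

End Cnear_matrix.

(** * Smoothness of [f] from smoothness of [h \o f] *)

Section Lifting.
Context {R : realType}.

(** The increments of [f] and [h \o f] differ by a small multiple of the increment of [f]. This
    bounds the increment of [f] by a multiple of the displacement, and then both have the same
    linear part. *)
Lemma differentiable_lift_id (U V : normedModType R) (f : U -> V) (h : V -> V) x :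
  {for x, continuous f} -> differentiable h (f x) ->
  'd h (f x) = idfun :> (V -> V) -> differentiable (h \o f) x ->
  differentiable f x.
Proof.
move=> fc hd hid gd; pose g := h \o f.
have dgc := diff_continuous gd.
have [C C0 gC] := linear_lipschitz dgc.
apply: (proj1 (@differentiable_leP _ _ _ f x ('d g x) dgc _)) => e e0.
(* Chosen so that [e1 <= 1/4], which lets [r2] absorb the term in [r], and so that
   [e1 * (2 * (C + e)) = e / 2], which with the error [e / 2] of [g] adds up to [e]. *)
pose e1 := e / (4 * (C + e)).
have e10 : 0 < e1 by rewrite divr_gt0 // mulr_gt0 // addr_gt0.
have e2 : 0 < e / 2 by rewrite divr_gt0.
have H1 := differentiable_le hd e10.
have H2 := differentiable_le gd e2.
have fx : (fun y => f (y + x) - f x) @ (0 : U) --> (0 : V).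
  rewrite -(subrr (f x)); apply: cvgB; last exact: cvg_cst.
  have : (fun y : U => y + x) @ 0 --> x.
    by rewrite -{2}(add0r x); apply: cvgD; [exact: cvg_id|exact: cvg_cst].
  by move=> s; apply: cvg_comp s fc.
have {}H1 := fx _ H1.
near=> y.
have h1 : `|h (f (y + x) - f x + f x) - h (f x) - 'd h (f x) (f (y + x) - f x)|
    <= e1 * `|f (y + x) - f x| by near: y.
have h2 : `|g (y + x) - g x - 'd g x y| <= e / 2 * `|y| by near: y.
move: h1; rewrite subrK hid /= => h1.
set r := f (y + x) - f x in h1 *; rewrite -/(g x) -/(g (y + x)) in h1.
have gy := gC y.
have rle : `|r| <= `|g (y + x) - g x - r| + `|g (y + x) - g x - 'd g x y| + `|'d g x y|.
  have {1}-> : r = - (g (y + x) - g x - r) + (g (y + x) - g x - 'd g x y) + 'd g x y.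
    by rewrite opprB addrA subrK subrK.
  by apply: le_trans (ler_normD _ _) _; rewrite lerD2r;
     apply: le_trans (ler_normD _ _) _; rewrite normrN.
have dle : `|r - 'd g x y| <= `|g (y + x) - g x - r| + `|g (y + x) - g x - 'd g x y|.
  have -> : r - 'd g x y = - (g (y + x) - g x - r) + (g (y + x) - g x - 'd g x y).
    by rewrite opprB addrA subrK.
  by apply: le_trans (ler_normD _ _) _; rewrite normrN.
have e1E : e1 * (4 * (C + e)) = e by rewrite divfK // gt_eqF // mulr_gt0 // addr_gt0.
have y0 : 0 <= `|y| by [].
have r0 : 0 <= `|r| by [].
apply: (le_trans dle).
move: h1 h2 rle; set N1 := `|g (y + x) - g x - r|; set N2 := `|_ - 'd g x y|.
move=> h1 h2 rle.
have e1le : e1 <= 4^-1.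
  by rewrite ler_pdivrMr ?mulr_gt0 ?addr_gt0 // mulrA mulVf // mul1r lerDr ltW.
(* In [rle], [N1] is at most a quarter of the norm of [r] and moves to the left-hand side. *)
have r2 : `|r| <= 2 * (C + e) * `|y|.
  have : e1 * `|r| <= 4^-1 * `|r| by rewrite ler_wpM2r.
  have : 0 <= e * `|y| by rewrite mulr_ge0 // ltW.
  have : 0 <= C * `|y| by rewrite mulr_ge0 // ltW.
  nra.
have : e1 * `|r| <= e1 * (2 * (C + e) * `|y|) by rewrite ler_wpM2l // ltW.
have -> : e1 * (2 * (C + e) * `|y|) = e / 2 * `|y| by rewrite -{2}e1E; field.
lra.
Unshelve. all: by end_near. Qed.

(** Following [h] by right multiplication by [B] turns its differential at [f x] into the
    identity. *)
Lemma differentiable_lift m n p (h : 'rV[R]_n -> 'rV[R]_p) (f : 'rV[R]_m -> 'rV[R]_n)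
    x (B : 'M[R]_(p, n)) :
  {for x, continuous f} -> differentiable h (f x) ->
  jacobian h (f x) *m B = 1%:M -> differentiable (h \o f) x ->
  differentiable f x.
Proof.
move=> fc hd JB hfd.
pose L : {linear 'rV[R]_p -> 'rV[R]_n} := mulmxr B.
have Ld y : differentiable L y.
  by apply: linear_differentiable; exact: mx_linear_continuous.
apply: (@differentiable_lift_id _ _ f (L \o h)) => //.
- exact: differentiable_comp.
- rewrite diff_comp // diff_lin; last exact: mx_linear_continuous.
  apply/funext => v /=; rewrite -(deriveE v hd) deriveEjacobian //.
  by rewrite /= -mulmxA JB mulmx1.
- by rewrite -compA; exact: differentiable_comp.
Qed.

(** The Jacobian assembled from directional derivatives, the form in which [Cnear] controls it. *)
Definition dmx m n (h : 'rV[R]_m -> 'rV[R]_n) w : 'M[R]_(m, n) :=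
  \matrix_(i, j) 'D_(delta_mx 0 i) h w 0 j.

Lemma dmxE m n (h : 'rV[R]_m -> 'rV[R]_n) w :
  differentiable h w -> dmx h w = jacobian h w.
Proof.
by move=> hd; apply/matrixP => i j; rewrite !mxE deriveE.
Qed.

Lemma Cnear_dmx k m n (h : 'rV[R]_m -> 'rV[R]_n) w :
  Cnear k.+1 h w -> Cnear k (dmx h) w.
Proof.
move=> hc; apply: Cnear_mx => i j.
rewrite [X in Cnear _ X _](_ : _ = (fun z => 'D_(delta_mx 0 i) h z 0 j)).
  apply: Cnear_entry; have [_] := nbhs_singleton hc; exact.
by apply/funext => z; rewrite mxE.
Qed.

(** Rows of the kernel matrix are sent to 0 by the differential, hence vanish. Since matrices act on
    row vectors from the right, [B] on the right is a left inverse of the differential. *)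
Lemma jacobian_left_inverse m n (h : 'rV[R]_m -> 'rV[R]_n) w :
  injective ('d h w) -> exists B, jacobian h w *m B = 1%:M.
Proof.
move=> dinj; apply/row_freeP; rewrite -kermx_eq0; apply/eqP/row_matrixP => i.
rewrite row0; apply: dinj; rewrite linear0 -[LHS]mul_rV_lin1 -row_mul.
by rewrite mulmx_ker row0.
Qed.

(** Near [x], ['D_v f z = 'D_v (h \o f) z *m (B *m invmx (M z))]. The right-hand side contains [f]
    but no derivative of [f], so it is of class C^k when [f] is, and [f] is then of class
    C^(k+1). *)
Lemma Cnear_lift k m n p (h : 'rV[R]_n -> 'rV[R]_p) (f : 'rV[R]_m -> 'rV[R]_n) x :
  (forall k, Cnear k h (f x)) -> injective ('d h (f x)) ->
  (\forall z \near x, {for z, continuous f}) ->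
  (forall k, Cnear k (h \o f) x) -> Cnear k f x.
Proof.
move=> hc dinj fc hfc; elim: k => [//|k IH].
have fx := nbhs_singleton fc.
have [B JB] := jacobian_left_inverse dinj.
have hd : \forall w \near f x, differentiable h w.
  by apply: filterS (hc 1%N) => w [].
have fhd : \forall z \near x, differentiable h (f z) := fx _ hd.
have hfd : \forall z \near x, differentiable (h \o f) z.
  by apply: filterS (hfc 1%N) => z [].
(* [B] inverts the Jacobian at [f x] only. For [z] near [x], [M z] stays invertible, and
   [B *m invmx (M z)] is the inverse at [f z]. *)
pose M z := dmx h (f z) *m B.
have Mc j : Cnear j f x -> Cnear j M x.
  move=> fj; apply: Cnear_mulmx; last exact: Cnear_cst.
  by apply: (@Cnear_comp _ _ _ _ _ _ f (dmx h)) => //; exact: Cnear_dmx.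
have Mx : M x \in unitmx.
  by rewrite /M dmxE ?JB ?unitmx1 //; exact: nbhs_singleton fhd.
have Mu := near_unitmx (Mc 0%N fc) Mx.
have MV := Cnear_near (Cnear_invmx Mx (Mc k IH)).
have hfk := Cnear_near (hfc k.+1).
have fd : \forall z \near x, differentiable f z.
  near=> z.
  have hdz : differentiable h (f z) by near: z.
  apply: (@differentiable_lift _ _ _ h f z (B *m invmx (M z))); try by near: z.
  rewrite mulmxA -(dmxE hdz); apply: mulmxV; by near: z.
have fd' := near_join fd; have fhd' := near_join fhd; have Mu' := near_join Mu.
rewrite /=; near=> z; split; first by near: z.
move=> v; apply: (@Cnear_eq _ _ _ _
    (fun y => 'D_v (h \o f) y *m (B *m invmx (M y)))).
  have z1 : \forall y \near z, differentiable f y by near: z.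
  have z2 : \forall y \near z, differentiable h (f y) by near: z.
  have z3 : \forall y \near z, M y \in unitmx by near: z.
  near=> y.
  have y1 : differentiable f y by near: y.
  have y2 : differentiable h (f y) by near: y.
  rewrite deriveE; last exact: differentiable_comp.
  rewrite diff_comp //= -(deriveE v y1) -(deriveE _ y2) deriveEjacobian //.
  have y3 : M y \in unitmx by near: y.
  rewrite -(dmxE y2) -mulmxA (mulmxA (dmx _ _)).
  by rewrite -[RHS]mulmx1; congr (_ *m _); exact: mulmxV.
have zz : Cnear k.+1 (h \o f) z by near: z.
have [_ zv] := nbhs_singleton zz.
apply: Cnear_mulmx; first exact: zv.
by apply: Cnear_mulmx; [exact: Cnear_cst|near: z].
Unshelve. all: by end_near. Qed.

End Lifting.

(** * Local sections of submersions between coordinate spaces *)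

(** Completeness of the space of row vectors, for [banach_fixed_point]. *)
HB.instance Definition _ (R : realType) (m n : nat) :=
  Uniform_isComplete.Build 'M[R]_(m, n) cauchy_cvg.

Section LocalSection.
Context {R : realType}.

Lemma derive_along_line (V W : normedModType R) (f : V -> W) (u w : V) t :
  derivable f (t *: w + u) w ->
  is_derive t 1 (fun s : R => f (s *: w + u)) ('D_w f (t *: w + u)).
Proof.
have E : (fun h : R => h^-1 *: (((fun s : R => f (s *: w + u)) \o shift t) (h *: 1)
    - f (t *: w + u))) =
  (fun h : R => h^-1 *: ((f \o shift (t *: w + u)) (h *: w) - f (t *: w + u))).
  apply/funext => h; rewrite /= addrA -scalerDl.
  by congr (_ *: (f (_ *: w + _) - _)); rewrite /GRing.scale /= mulr1.
by move=> fd; split; rewrite /derivable /derive E.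
Qed.

(** The norm is the largest absolute value of an entry, so the real mean value theorem can be
    applied to each entry on the segment from [v] to [u], with an intermediate point of its own. By
    convexity the segment stays in the ball. *)
Lemma mean_value_le n p (f : 'rV[R]_n -> 'rV[R]_p) (r q : R) :
  0 <= q ->
  (forall z, `|z| <= r -> differentiable f z) ->
  (forall z v, `|z| <= r -> `|'D_v f z| <= q * `|v|) ->
  forall u v : 'rV[R]_n, `|u| <= r -> `|v| <= r -> `|f u - f v| <= q * `|u - v|.
Proof.
move=> q0 fd fq u v ur vr; pose w : 'rV[R]_n := u - v.
have line (t : R) : 0 <= t <= 1 -> `|t *: w + v| <= r.
  move=> /andP[t0 t1].
  have -> : t *: w + v = t *: u + (1 - t) *: v.
    by rewrite /w scalerBr scalerBl scale1r addrA addrAC -addrA.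
  apply: le_trans (ler_normD _ _) _; rewrite !normrZ ger0_norm //.
  rewrite (ger0_norm (_ : 0 <= 1 - t)) ?subr_ge0 //.
  have : t * `|u| <= t * r by rewrite ler_wpM2l.
  have : (1 - t) * `|v| <= (1 - t) * r by rewrite ler_wpM2l // subr_ge0.
  lra.
rewrite [leLHS]/Num.Def.normr/= mx_normrE.
apply: bigmax_le => [|[i j] _ /=]; first by rewrite mulr_ge0.
pose g (s : R) : R := f (s *: w + v) i j.
have gd (t : R) : 0 <= t <= 1 -> is_derive t 1 g ('D_w f (t *: w + v) i j).
  move=> /line tr.
  have fdt : derivable f (t *: w + v) w by apply: diff_derivable; exact: fd.
  have fdij := (derivable_mxP _ _ _).1 fdt i j.
  by rewrite (derive_mx fdt) mxE; exact: derive_along_line.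
have gc : {within `[0, 1], continuous g}.
  apply: derivable_within_continuous => t; rewrite in_itv /= => t01.
  by have := gd t t01; case.
have [|c c01] := @MVT R g (fun t => 'D_w f (t *: w + v) i j) 0 1 ltr01 _ gc.
  by move=> t; rewrite in_itv /= => /andP[t0 t1]; apply: gd; rewrite !ltW.
rewrite subr0 mulr1 /g scale1r scale0r add0r /w subrK !mxE => ->.
apply: le_trans (fq (c *: (u - v) + v) (u - v) _); last first.
  by apply: line; move: c01; rewrite in_itv /= => /andP[c0 c1]; rewrite !ltW.
rewrite [leRHS]/Num.Def.normr/= mx_normrE.
exact: (le_bigmax _ (fun ij : 'I_1 * 'I_p => `|_ ij.1 ij.2|) (i, j)).
Qed.

Lemma derive_le n (W : normedModType R) (f : 'rV[R]_n -> W) z v (q : R) : 0 <= q ->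
  differentiable f z -> (forall j, `|'D_(delta_mx 0 j) f z| <= q / n%:R) ->
  `|'D_v f z| <= q * `|v|.
Proof.
move=> q0 fd fq; rewrite deriveE // linear_mx_sum big_ord1.
apply: le_trans (ler_norm_sum _ _ _) _.
have vj j : `|v 0 j| <= `|v|.
  rewrite [leRHS]/Num.Def.normr/= mx_normrE.
  exact: (le_bigmax _ (fun ij : 'I_1 * 'I_n => `|v ij.1 ij.2|) (0, j)).
apply: (@le_trans _ _ (\sum_(j < n) q / n%:R * `|v|)).
  apply: ler_sum => j _; rewrite normrZ mulrC -(deriveE _ fd).
  by apply: ler_pM => //.
(* For [n = 0] the sum is empty; otherwise the [n] terms cancel the division by [n]. *)
rewrite sumr_const card_ord; case: n {f z fd fq vj} v => [|n] v.
  by rewrite mulr0n mulr_ge0.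
by rewrite -[leLHS]mulr_natr mulrAC divfK // pnatr_eq0.
Qed.

(* For y near g 0, the map u |-> u - g u + y is a contraction of a small closed
   ball, and its fixed point solves g u = y. *)
Lemma local_right_inverse_id n (g : 'rV[R]_n -> 'rV[R]_n) :
  Cnear 1 g 0 -> 'd g 0 = idfun :> ('rV[R]_n -> 'rV[R]_n) ->
  exists t : 'rV[R]_n -> 'rV[R]_n,
    [/\ t (g 0) = 0, \forall y \near g 0, g (t y) = y &
        \forall y \near g 0, {for y, continuous t}].
Proof.
move=> gc gid; pose f : 'rV[R]_n -> 'rV[R]_n := id - g.
have gd : \forall z \near (0 : 'rV[R]_n), differentiable g z by apply: filterS gc => z [].
have idd z : differentiable (@id 'rV[R]_n) z by exact: ex_diff.
have fd : \forall z \near (0 : 'rV[R]_n), differentiable f z.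
  by apply: filterS gd => z zd; exact: differentiableB.
have fD z v : differentiable g z -> 'D_v f z = v - 'D_v g z.
  by move=> zd; rewrite deriveB ?derive_id //; exact: diff_derivable.
(* The differential of [f] vanishes at 0, so its partial derivatives are small nearby. This bound is
   the one that [derive_le] turns into the Lipschitz constant 1/2. *)
have fq : \forall z \near (0 : 'rV[R]_n),
    forall j, `|'D_(delta_mx 0 j) f z| <= 2^-1 / n%:R.
  suff H : forall j : 'I_n, \forall z \near (0 : 'rV[R]_n),
      `|'D_(delta_mx 0 j) f z| <= 2^-1 / n%:R.
    exact: filter_forall H.
  move=> j.
  have [_ /(_ (delta_mx 0 j)) /= Dc] := nbhs_singleton gc.
  have D0 : 'D_(delta_mx 0 j) g 0 = delta_mx 0 j.
    by rewrite deriveE ?gid //; exact: nbhs_singleton gd.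
  have n0 : (0 < n)%N by exact: leq_ltn_trans (leq0n j) (ltn_ord j).
  have e0 : 0 < 2^-1 / n%:R :> R by rewrite divr_gt0 ?invr_gt0 // ltr0n.
  have /cvgrPdist_le /(_ _ e0) := nbhs_singleton Dc; rewrite D0 => H.
  by near=> z; rewrite fD; near: z.
have [r r0 rP] : exists2 r : R, 0 < r & forall z : 'rV[R]_n, `|z| <= r ->
    differentiable f z /\ forall j, `|'D_(delta_mx 0 j) f z| <= 2^-1 / n%:R.
  have : \forall z \near (0 : 'rV[R]_n),
    differentiable f z /\ forall j, `|'D_(delta_mx 0 j) f z| <= 2^-1 / n%:R.
    by near=> z; split; near: z.
  move=> /nbhs_normP[e /= e0 eP]; exists (e / 2); first by rewrite divr_gt0.
  move=> z ze; apply: eP; rewrite /= sub0r normrN (le_lt_trans ze) //.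
  by rewrite ltr_pdivrMr // ltr_pMr // ltr1n.
have f_lip u v : `|u| <= r -> `|v| <= r -> `|f u - f v| <= 2^-1 * `|u - v|.
  apply: (@mean_value_le n n f r 2^-1); first by rewrite invr_ge0.
    by move=> z /rP[].
  by move=> z w /rP[zd zq]; apply: derive_le => //; rewrite invr_ge0.
pose U := [set u : 'rV[R]_n | `|u| <= r].
have U0 : U 0 by rewrite /U /= normr0 ltW.
have Ucl : closed U.
  rewrite (_ : U = closed_ball_ (fun x => `|x|) 0 r); first exact: closed_closed_ball_.
  by apply/seteqP; split => z; rewrite /U /closed_ball_ /= sub0r normrN.
(* On the ball [f u - f 0] has norm at most [r / 2], which leaves [r / 2] for [y - g 0] if [T] is to
   map the ball to itself. *)
have fix_ex y : `|y - g 0| <= r / 2 -> exists u, U u /\ g u = y.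
  move=> yr; pose T u := f u + y.
  have TU : set_fun U U T.
    move=> u /= ur; have := f_lip u 0 ur U0; rewrite subr0.
    have -> : T u = (f u - f 0) + (y - g 0).
      by rewrite /T /f !fctE add0r opprK addrACA subrr addr0.
    move=> H; apply: le_trans (ler_normD _ _) _.
    have : `|u| <= r by []; lra.
  pose Tf : @Fun.type 'rV[R]_n 'rV[R]_n U U := HB.pack T (isFun.Build _ _ _ _ _ TU).
  have Tctr : is_contraction Tf.
    exists (2^-1)%:nng; split; first by rewrite /= invf_lt1 // ltr1n.
    move=> [u v] [/= ur vr]; rewrite /Tf /= /T opprD addrACA subrr addr0.
    exact: f_lip.
  have [u Uu uE] := banach_fixed_point Tctr Ucl (ex_intro _ _ U0).
  exists u; split=> //.
  have : u = u - g u + y by exact: uE.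
  by move=> /eqP; rewrite -addrA -subr_eq0 opprD addrA subrr sub0r oppr_eq0
    addrC subr_eq0 eq_sym => /eqP.
(* The default 0 is taken only if [y] has no preimage in [U], which by [fix_ex] does not happen near
   [g 0]. *)
pose t y := xget 0 [set u | U u /\ g u = y].
have tP y : `|y - g 0| <= r / 2 -> U (t y) /\ g (t y) = y.
  by move=> yr; apply: (xgetPex 0 (fix_ex y yr)).
(* Since [id = f + g] and [f] halves distances, [g] is injective on [U] with a 2-Lipschitz inverse.
   This yields both [t (g 0) = 0] and the continuity of [t]. *)
have g_lip u v : U u -> U v -> `|u - v| <= 2 * `|g u - g v|.
  move=> Uu Uv; have := f_lip u v Uu Uv.
  have : `|u - v| <= `|f u - f v| + `|g u - g v|.
    suff <- : f u - f v + (g u - g v) = u - v by exact: ler_normD.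
    by rewrite /f !fctE opprB addrACA subrK (addrAC (g v)) subrr sub0r.
  by have : 0 <= `|u - v| by []; lra.
have r20 : 0 < r / 2 by rewrite divr_gt0.
have near_g0 : \forall y \near g 0, `|y - g 0| <= r / 2.
  apply/nbhs_normP; exists (r / 2) => //= y; rewrite /= distrC; exact: ltW.
exists t; split.
- have g00 : `|g 0 - g 0| <= r / 2 by rewrite subrr normr0 ltW.
  have [Ut gt] := tP _ g00; apply/eqP; rewrite -subr_eq0 -normr_le0.
  by apply: le_trans (g_lip _ _ Ut U0) _; rewrite gt subrr normr0 mulr0.
- by apply: filterS near_g0 => y /tP[].
- apply: filterS (near_join near_g0) => y yn.
  have [Uy gy] := tP _ (nbhs_singleton yn).
  apply: (proj2 (@cvgrPdist_le _ _ _ (nbhs y) _ t (t y))) => e e0.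
  have e20 : 0 < e / 2 by rewrite divr_gt0.
  have H : \forall z \near y, `|y - z| <= e / 2.
    by apply/nbhs_normP; exists (e / 2) => //= z /ltW.
  suff : \forall z \near y, `|t y - t z| <= e by [].
  near=> z.
  have zr : `|z - g 0| <= r / 2 by near: z.
  have [Uz gz] := tP _ zr.
  apply: le_trans (g_lip _ _ Uy Uz) _; rewrite gy gz.
  by rewrite mulrC -ler_pdivlMr //; near: z.
Unshelve. all: by end_near. Qed.

(** Surjectivity puts each basis vector in the row space of the Jacobian; [u |-> u *m B] is then a
    right inverse of the differential. *)
Lemma jacobian_right_inverse m n (h : 'rV[R]_m -> 'rV[R]_n) w :
  (forall v, exists u, 'd h w u = v) -> exists B, B *m jacobian h w = 1%:M.
Proof.
move=> dsurj; apply/row_fullP; rewrite -sub1mx; apply/row_subP => i.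
have [u <-] := dsurj (row i 1%:M).
by rewrite -[X in (X <= _)%MS]mul_rV_lin1 submxMl.
Qed.

Lemma diff_affine (V W : normedModType R) (L : {linear V -> W}) c x :
  continuous L -> 'd (fun u => L u + c) x = L :> (V -> W).
Proof.
move=> Lc; apply: (proj2 (@differentiable_leP _ _ _ _ x L Lc _)) => e e0.
apply: nearW => h; rewrite linearD opprD addrACA subrr addr0 addrK subrr.
by rewrite normr0 mulr_ge0 // ltW.
Qed.

(** Restricting [f] to the affine slice [l] through [x], which is transverse to the kernel of the
    differential, gives a map [g] with identity differential at 0. Its local inverse, followed by
    [l], is the section. *)
Lemma local_section m n (f : 'rV[R]_m -> 'rV[R]_n) x :
  (forall k, Cnear k f x) -> (forall v, exists u, 'd f x u = v) ->
  exists s : 'rV[R]_n -> 'rV[R]_m,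
    [/\ s (f x) = x, \forall y \near f x, f (s y) = y &
        forall k, Cnear k s (f x)].
Proof.
move=> fc fsurj; have [B BJ] := jacobian_right_inverse fsurj.
pose l u := u *m B + x; pose g := f \o l.
have l0 : l 0 = x by rewrite /l mul0mx add0r.
have lc k z : Cnear k l z.
  apply: (@CnearD _ _ _ _ (fun u => u *m B) (cst x)); last exact: Cnear_cst.
  by apply: Cnear_mulmx; [exact: Cnear_id|exact: Cnear_cst].
have gc k : Cnear k g 0 by apply: Cnear_comp => //; rewrite l0.
have fd : differentiable f x by have [] := nbhs_singleton (fc 1%N).
have ld : differentiable l 0 by have [] := nbhs_singleton (lc 1%N 0).
have dl : 'd l 0 = mulmxr B :> ('rV[R]_n -> 'rV[R]_m).
  by apply: (diff_affine (L := mulmxr B)); exact: mx_linear_continuous.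
have gid : 'd g 0 = idfun :> ('rV[R]_n -> 'rV[R]_n).
  apply/funext => v; rewrite diff_comp ?l0 // [LHS]/= dl -(deriveE _ fd).
  by rewrite deriveEjacobian // -mulmxA BJ mulmx1.
have [t [t0 tK tc]] := local_right_inverse_id (gc 1%N) gid.
have g0 : g 0 = f x by rewrite /g /= l0.
have tC k : Cnear k t (g 0).
  apply: (@Cnear_lift _ _ _ _ _ g).
  - by rewrite t0.
  - by rewrite t0 gid.
  - exact: tc.
  - move=> j; apply: (@Cnear_eq _ _ _ _ id); last exact: Cnear_id.
    by apply: filterS tK => y /= ->.
exists (l \o t); split.
- by rewrite /= -g0 t0 l0.
- by rewrite -g0.
- by move=> k; rewrite -g0; apply: Cnear_comp.
Qed.

End LocalSection.

(** * Smooth maps between manifolds, point by point in charts *)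

Section Charts.
Context {R : realType}.

Lemma cinv_cvg n (M : topologicalType) (c : chart R n M) x :
  is_chart c -> cdom c x -> cinv c @ cmap c x --> x.
Proof.
move=> [_ _ cK _ cc] cx.
by have := cc _ (imageP (cmap c) cx); rewrite /prop_for /continuous_at cK.
Qed.

Lemma near_chart n (M : topologicalType) (c : chart R n M) x (P : set M) :
  is_chart c -> cdom c x -> (\forall z \near x, P z) ->
  \forall y \near cmap c x, P (cinv c y).
Proof. by move=> hc cx; exact: cinv_cvg. Qed.

Lemma near_cdom n (M : topologicalType) (c : chart R n M) x :
  is_chart c -> cdom c x -> \forall z \near x, cdom c z.
Proof. by move=> [oc _ _ _ _] cx; exact: open_nbhs_nbhs. Qed.

Lemma near_cmapK n (M : topologicalType) (c : chart R n M) x :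
  is_chart c -> cdom c x ->
  \forall y \near cmap c x, cdom c (cinv c y) /\ cmap c (cinv c y) = y.
Proof.
move=> [_ oi cK _ _] cx.
have := open_nbhs_nbhs (conj oi (imageP (cmap c) cx)).
by apply: filterS => _ [z cz <-]; rewrite cK.
Qed.

(** A pointwise notion is called for because a local section is a total function whose values far
    from the base point are arbitrary. *)
Definition smooth_at m n (M N : topologicalType) (aM : atlas R m M)
    (aN : atlas R n N) (f : M -> N) (x : M) : Prop :=
  {for x, continuous f} /\
  forall c d, aM c -> aN d -> cdom c x -> cdom d (f x) ->
    forall k, Cnear k (coord_rep c d f) (cmap c x).

(** Smooth transition maps are stated as smoothness of the identity, so that a change of chart is a
    composition. The notion passes to product atlases by [prod_smooth_atlas]. *)
Definition smooth_atlas n (M : topologicalType) (aM : atlas R n M) : Prop :=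
  [/\ forall c, aM c -> is_chart c,
      forall x, exists2 c, aM c & cdom c x &
      forall x, smooth_at aM aM id x].

Lemma open_chart_image n (M : topologicalType) (c : chart R n M) (U : set M) :
  is_chart c -> open U -> open (cmap c @` (cdom c `&` U)).
Proof.
move=> hc oU; rewrite openE => _ [x [cx Ux] <-].
have H1 := near_cmapK hc cx.
have H2 := near_chart hc cx (open_nbhs_nbhs (conj oU Ux)).
by near=> y; exists (cinv c y); [split|]; near: y => //; apply: filterS H1 => y [].
Unshelve. all: by end_near. Qed.

Lemma smooth_mapP m n (M N : topologicalType) (aM : atlas R m M)
    (aN : atlas R n N) (f : M -> N) :
  (forall c, aM c -> is_chart c) -> (forall d, aN d -> is_chart d) ->
  smooth_map aM aN f <-> forall x, smooth_at aM aN f x.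
Proof.
move=> hM hN.
have oU c d : continuous f -> aM c -> aN d ->
    open (cmap c @` (cdom c `&` f @^-1` cdom d)).
  move=> fc Mc Nd; apply: open_chart_image; first exact: hM.
  by apply: open_comp => [x _|]; [exact: fc|have [] := hN d Nd].
split=> [[fc fs] x|fs].
  split=> [|c d Mc Nd cx dx k]; first exact: fc.
  have /(CkP _ _ (oU _ _ fc Mc Nd)) := fs c d Mc Nd k; apply.
  by exists x.
have fc : continuous f by move=> x; have [] := fs x.
split=> // c d Mc Nd k; apply/(CkP _ _ (oU _ _ fc Mc Nd)) => _ [x [cx dx] <-].
by have [_] := fs x; apply.
Qed.

Lemma smooth_at_eq m n (M N : topologicalType) (aM : atlas R m M)
    (aN : atlas R n N) (f g : M -> N) x :
  (forall c, aM c -> is_chart c) -> (\near x, f x = g x) ->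
  smooth_at aM aN f x -> smooth_at aM aN g x.
Proof.
move=> hM fg [fc fs]; split.
  rewrite /prop_for /continuous_at -(nbhs_singleton fg).
  by apply: cvg_trans fc; exact: near_eq_cvg.
move=> c d Mc Nd cx dx k; apply: Cnear_eq (fs c d Mc Nd cx _ k).
  have := near_chart (hM c Mc) cx fg.
  by apply: filterS => y; rewrite /coord_rep /= => ->.
by rewrite (nbhs_singleton fg).
Qed.

Lemma coord_repE m n (M N : topologicalType) (c : chart R m M) (d : chart R n N)
    (f : M -> N) x :
  is_chart c -> cdom c x -> coord_rep c d f (cmap c x) = cmap d (f x).
Proof. by move=> [_ _ cK _ _] cx; rewrite /coord_rep /= cK. Qed.

(** [cinv d] undoes [cmap d] only on [cdom d], where continuity of [f] at [x] keeps the nearby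
    values. *)
Lemma coord_rep_comp m n p (M N P : topologicalType) (c : chart R m M)
    (d : chart R n N) (e : chart R p P) (f : M -> N) (g : N -> P) x :
  is_chart c -> is_chart d -> cdom c x -> cdom d (f x) ->
  {for x, continuous f} ->
  \forall y \near cmap c x,
    (coord_rep d e g \o coord_rep c d f) y = coord_rep c e (g \o f) y.
Proof.
move=> hc hd cx dx fc.
have : \forall z \near x, cdom d (f z) by exact: fc _ (near_cdom hd dx).
move=> /(near_chart hc cx); apply: filterS => y dy.
by have [_ _ dK _ _] := hd; rewrite /coord_rep /= dK.
Qed.

Lemma smooth_at_comp m n p (M N P : topologicalType) (aM : atlas R m M)
    (aN : atlas R n N) (aP : atlas R p P) (f : M -> N) (g : N -> P) x :
  (forall c, aM c -> is_chart c) -> smooth_atlas aN ->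
  smooth_at aM aN f x -> smooth_at aN aP g (f x) ->
  smooth_at aM aP (g \o f) x.
Proof.
move=> hM [hN Ncov _] [fc fs] [gc gs]; split; first exact: continuous_comp.
move=> c e Mc Pe cx ex k; have [d Nd dx] := Ncov (f x).
apply: Cnear_eq (coord_rep_comp e g (hM c Mc) (hN d Nd) cx dx fc) _.
apply: Cnear_comp; first exact: fs.
by rewrite coord_repE //; [exact: gs|exact: hM].
Qed.

(** Other charts around [x] and [f x] differ from [c] and [d] by coordinate representations of [id],
    which are smooth. *)
Lemma smooth_at_chart m n (M N : topologicalType) (aM : atlas R m M)
    (aN : atlas R n N) (f : M -> N) x c d :
  smooth_atlas aM -> smooth_atlas aN -> {for x, continuous f} ->
  aM c -> aN d -> cdom c x -> cdom d (f x) ->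
  (forall k, Cnear k (coord_rep c d f) (cmap c x)) -> smooth_at aM aN f x.
Proof.
move=> [hM _ Mid] [hN _ Nid] fc Mc Nd cx dx fs; split=> // c' d' Mc' Nd' cx' dx' k.
have hc := hM c Mc; have hd := hN d Nd.
have hc' := hM c' Mc'; have hd' := hN d' Nd'.
have idc y : {for y, continuous (@id M)} by exact: cvg_id.
have E1 := coord_rep_comp d' f hc' hc cx' cx (idc x).
have E2 := coord_rep_comp d' id hc hd cx dx fc.
apply: (Cnear_eq E1); apply: Cnear_comp.
  by have [_] := Mid x; apply.
rewrite coord_repE //; apply: (Cnear_eq E2); apply: Cnear_comp => //.
by rewrite coord_repE //; have [_] := Nid (f x); apply.
Qed.

Lemma manifold_smooth_atlas n (M : topologicalType) (aM : atlas R n M) :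
  is_manifold aM -> smooth_atlas aM.
Proof.
move=> [_ _ hM Mcov Mtr]; split=> //.
move=> x; apply: (proj1 (smooth_mapP id hM hM)).
by split=> // y; exact: cvg_id.
Qed.

Lemma continuous_pair (T U V : topologicalType) (f : T -> U) (g : T -> V) x :
  {for x, continuous f} -> {for x, continuous g} ->
  {for x, continuous (fun z => (f z, g z))}.
Proof. by move=> fc gc; exact: cvg_pair. Qed.

Lemma smooth_at_pair m n p (M N P : topologicalType) (aM : atlas R m M)
    (aN : atlas R n N) (aP : atlas R p P) (f : M -> N) (g : M -> P) x :
  smooth_at aM aN f x -> smooth_at aM aP g x ->
  smooth_at aM (prod_atlas aN aP) (fun z => (f z, g z)) x.
Proof.
move=> [fc fs] [gc gs]; split; first exact: continuous_pair.
move=> c _ Mc [d [e [Nd Pe ->]]] cx [/= dx ex] k; apply: Cnear_mx => i j.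
have [l Dl|l Dl] := split_ordP j.
  rewrite [X in Cnear _ X _](_ : _ = fun y => coord_rep c d f y i l).
    by apply: Cnear_entry; exact: fs.
  by apply/funext => y; rewrite /coord_rep /= Dl row_mxEl.
rewrite [X in Cnear _ X _](_ : _ = fun y => coord_rep c e g y i l).
  by apply: Cnear_entry; exact: gs.
by apply/funext => y; rewrite /coord_rep /= Dl row_mxEr.
Qed.

Lemma smooth_at_fst m n (M N : topologicalType) (aM : atlas R m M)
    (aN : atlas R n N) p :
  smooth_atlas aM -> smooth_at (prod_atlas aM aN) aM fst p.
Proof.
move=> [_ _ Mid]; split; first exact: cvg_fst.
move=> _ c' [c [d [Mc Nd ->]]] Mc' [/= cp dp] cp' k.
apply: (@Cnear_comp _ _ _ _ _ _ lsubmx (coord_rep c c' id)).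
  by apply: (Cnear_mx_linear lsubmx); exact: Cnear_id.
by rewrite /= row_mxKl; have [_] := Mid p.1; apply.
Qed.

Lemma smooth_at_snd m n (M N : topologicalType) (aM : atlas R m M)
    (aN : atlas R n N) p :
  smooth_atlas aN -> smooth_at (prod_atlas aM aN) aN snd p.
Proof.
move=> [_ _ Nid]; split; first exact: cvg_snd.
move=> _ d' [c [d [Mc Nd ->]]] Nd' [/= cp dp] dp' k.
apply: (@Cnear_comp _ _ _ _ _ _ rsubmx (coord_rep d d' id)).
  by apply: (Cnear_mx_linear rsubmx); exact: Cnear_id.
by rewrite /= row_mxKr; have [_] := Nid p.2; apply.
Qed.

Lemma prod_is_chart m n (M N : topologicalType) (c : chart R m M)
    (d : chart R n N) : is_chart c -> is_chart d -> is_chart (prod_chart c d).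
Proof.
move=> hc hd; have [oc oic cK cc cic] := hc; have [od oid dK dc did] := hd.
have imE : cmap (prod_chart c d) @` cdom (prod_chart c d) =
    (lsubmx @^-1` (cmap c @` cdom c)) `&` (rsubmx @^-1` (cmap d @` cdom d)).
  apply/seteqP; split=> [_ [[x y] /= [cx dy] <-]|z [/= [x cx Ex] [y dy Ey]]].
    by split=> /=; rewrite ?row_mxKl ?row_mxKr; exact: imageP.
  by exists (x, y) => //=; rewrite Ex Ey hsubmxK.
have lc (z : 'rV[R]_(m + n)) : {for z, continuous lsubmx}.
  exact: continuous_lsubmx.
have rc (z : 'rV[R]_(m + n)) : {for z, continuous rsubmx}.
  exact: continuous_rsubmx.
split.
- rewrite openE => -[x y] [/= cx dy].
  exists (cdom c, cdom d); last exact: subset_refl.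
  by split; [exact: open_nbhs_nbhs (conj oc cx)|exact: open_nbhs_nbhs (conj od dy)].
- by rewrite imE; apply: openI; apply: open_comp => // z _; [exact: lc|exact: rc].
- by move=> [x y] [/= cx dy]; rewrite row_mxKl row_mxKr cK // dK.
(* Concatenation of rows is written as a sum of two linear embeddings, whose continuity is known. *)
- move=> [x y] [/= cx dy]; rewrite (_ : (fun _ => _) =
      ((mulmxr (row_mx 1%:M 0) : 'rV[R]_m -> 'rV[R]_(m + n)) \o (cmap c \o fst)) +
      ((mulmxr (row_mx 0 1%:M) : 'rV[R]_n -> 'rV[R]_(m + n)) \o (cmap d \o snd)));
    last first.
    apply/funext => p; rewrite fctE /= !mul_mx_row !mulmx1 !mulmx0 add_row_mx.
    by rewrite addr0 add0r.
  apply: continuousD; (apply: continuous_comp; last exact: mx_linear_continuous).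
    by apply: continuous_comp; [exact: cvg_fst|exact: cc].
  by apply: continuous_comp; [exact: cvg_snd|exact: dc].
- rewrite imE => z [/= /cic zc /did zd]; apply: continuous_pair.
    exact: (@continuous_comp _ _ _ lsubmx (cinv c) z (lc z) zc).
  exact: (@continuous_comp _ _ _ rsubmx (cinv d) z (rc z) zd).
Qed.

Lemma prod_smooth_atlas m n (M N : topologicalType) (aM : atlas R m M)
    (aN : atlas R n N) :
  smooth_atlas aM -> smooth_atlas aN -> smooth_atlas (prod_atlas aM aN).
Proof.
move=> sM sN; have [hM Mcov _] := sM; have [hN Ncov _] := sN; split.
- by move=> _ [c [d [Mc Nd ->]]]; apply: prod_is_chart; [exact: hM|exact: hN].
- move=> [x y]; have [c Mc cx] := Mcov x; have [d Nd dy] := Ncov y.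
  by exists (prod_chart c d) => //; exists c, d.
- move=> p; rewrite [X in smooth_at _ _ X](_ : _ = fun z : M * N => (z.1, z.2)).
    by apply: smooth_at_pair; [exact: smooth_at_fst|exact: smooth_at_snd].
  by apply/funext => -[].
Qed.

Lemma submersion_section m n (M N : topologicalType) (aM : atlas R m M)
    (aN : atlas R n N) (f : M -> N) x :
  smooth_atlas aM -> smooth_atlas aN -> submersion aM aN f ->
  exists s : N -> M, [/\ s (f x) = x, \forall y \near f x, f (s y) = y &
    smooth_at aN aM s (f x)].
Proof.
move=> sM sN [fs fsub]; have [hM Mcov _] := sM; have [hN Ncov _] := sN.
have [c Mc cx] := Mcov x; have [d Nd dx] := Ncov (f x).
have hc := hM c Mc; have hd := hN d Nd.
have [_ _ cK cc cic] := hc; have [_ _ dK dc did] := hd.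
have [fc fx] := (smooth_mapP f hM hN).1 fs x.
have [t [tx tK tC]] := local_section (fx c d Mc Nd cx dx) (fsub c d x Mc Nd cx dx).
move: tx tK tC; rewrite coord_repE // => tx tK tC.
pose s y := cinv c (t (cmap d y)).
have sx : s (f x) = x by rewrite /s tx cK.
have tc : {for cmap d (f x), continuous t}.
  exact: nbhs_singleton (Cnear_continuous (tC 0%N)).
have sc : {for f x, continuous s}.
  have dcx : {for f x, continuous (cmap d)} by exact: dc.
  apply: (@continuous_comp _ _ _ (t \o cmap d) (cinv c)).
    exact: continuous_comp.
  by rewrite /= tx; apply: cic; exact: imageP.
(* [t] stays in the image of the chart [c], where [cmap c] and [cinv c] are inverse to each
   other. *)
have tcc : \forall w \near cmap d (f x), cdom c (cinv c (t w)) /\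
    cmap c (cinv c (t w)) = t w.
  have Nn : \forall u \near t (cmap d (f x)),
    cdom c (cinv c u) /\ cmap c (cinv c u) = u by rewrite tx; exact: near_cmapK.
  exact: tc _ Nn.
exists s; split=> //.
- have N1 : \forall y \near f x, cdom d y by exact: near_cdom.
  have N2 : \forall y \near f x, cdom d (f (s y)).
    have Nn : \forall z \near s (f x), cdom d (f z).
      by rewrite sx; exact: fc _ (near_cdom hd dx).
    exact: sc _ Nn.
  have N3 : \forall y \near f x, coord_rep c d f (t (cmap d y)) = cmap d y.
    exact: dc _ dx _ tK.
  near=> y.
  have y3 : coord_rep c d f (t (cmap d y)) = cmap d y by near: y.
  have y1 : cdom d y by near: y.
  have y2 : cdom d (f (s y)) by near: y.
  by rewrite -(dK _ y2) -[RHS](dK _ y1) -y3.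
- apply: (@smooth_at_chart _ _ _ _ _ _ s (f x) d c) => //; first by rewrite sx.
  move=> k; apply: Cnear_eq (tC k).
  have dK' := near_cmapK hd dx; near=> w.
  have [_ wE] : cdom d (cinv d w) /\ cmap d (cinv d w) = w by near: w.
  have [_ tE] : cdom c (cinv c (t w)) /\ cmap c (cinv c (t w)) = t w by near: w.
  by rewrite /coord_rep /= /s wE tE.
Unshelve. all: by end_near. Qed.

Lemma continuous_into_set_type (X N : topologicalType) (B : set N)
    (f : X -> set_type B) : continuous (set_val \o f) -> continuous f.
Proof.
by move=> fc; exact: (@continuous_comp_initial (set_type B) X N set_val f fc).
Qed.

(** Continuity of [f] into [P] is a hypothesis of its own: an immersion need not be a homeomorphism
    onto its image, so continuity of [i \o f] would not give it. *)
Lemma immersion_lift m n p (X P N : topologicalType) (aX : atlas R m X)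
    (aP : atlas R p P) (aN : atlas R n N) (i : P -> N) (f : X -> P) x :
  smooth_atlas aX -> smooth_atlas aP -> smooth_atlas aN ->
  immersion aP aN i -> continuous f -> smooth_at aX aN (i \o f) x ->
  smooth_at aX aP f x.
Proof.
move=> [hX _ _] [hP _ _] [hN Ncov _] [si iinj] fc [_ ifs].
split=> [|c d Xc Pd cx dx k]; first exact: fc.
have hc := hX c Xc; have hd := hP d Pd.
have [e Ne ex] := Ncov (i (f x)); have he := hN e Ne.
have [ic ix] := (smooth_mapP i hP hN).1 si (f x).
apply: (@Cnear_lift _ _ _ _ _ (coord_rep d e i)).
- by move=> j; rewrite coord_repE //; exact: ix.
- by rewrite coord_repE //; exact: iinj.
- have [_ _ cK _ cic] := hc; have [_ _ _ dc _] := hd.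
  have N1 := near_cmapK hc cx.
  have N2 : \forall y \near cmap c x, cdom d (f (cinv c y)).
    have N0 : \forall z \near x, cdom d (f z) by exact: fc _ _ (near_cdom hd dx).
    exact: near_chart hc cx N0.
  near=> y.
  have [cy yE] : cdom c (cinv c y) /\ cmap c (cinv c y) = y by near: y.
  have dy : cdom d (f (cinv c y)) by near: y.
  apply: (@continuous_comp _ _ _ (f \o cinv c) (cmap d)); last exact: dc.
  apply: continuous_comp; last exact: fc.
  by apply: cic; exists (cinv c y).
- move=> j; apply: Cnear_eq (ifs c e Xc Ne cx ex j).
  have := coord_rep_comp e i hc hd cx dx (fc x).
  by apply: filterS => y ->.
Unshelve. all: by end_near. Qed.

End Charts.

Lemma submersion_descent (R : realType) m n p (M N Z : topologicalType)
    (aM : atlas R m M) (aN : atlas R n N) (aZ : atlas R p Z)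
    (f : M -> N) (g : N -> Z) x :
  smooth_atlas aM -> smooth_atlas aN -> submersion aM aN f ->
  smooth_at aM aZ (g \o f) x -> smooth_at aN aZ g (f x).
Proof.
move=> sM sN fsub gfs; have [s [sx sK ss]] := submersion_section x sM sN fsub.
have [hN _ _] := sN.
apply: (@smooth_at_eq _ _ _ _ _ _ _ ((g \o f) \o s)) => //.
  by apply: filterS sK => y /= ->.
by apply: (smooth_at_comp hN sM ss); rewrite sx.
Qed.

(** * The bijection and its inverse *)

Section DiscreteConnection.
Context {G : groupTopologicalType} {Q : topologicalType} (a : left_action G Q).
Context (A : Q * Q -> G) (A_equiv : forall g h q0 q1,
  A (a g q0, a h q1) = (h * A (q0, q1) * g^-1)%g).

Definition bundle_map (z : pair_quot a) : set_type (fiber_sum a) :=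
  let p := orbit_repr z in
  oplus a (pr_base a p.1) (pr_base a p.2) p.1 (A p) (erefl (pr_base a p.1)).

Lemma connection_actr h q0 q1 : A (q0, a h q1) = (h * A (q0, q1))%g.
Proof. by rewrite -{1}(lact1 a q0) A_equiv invg1 mulg1. Qed.

(** Well-definedness: moving both points by [k] conjugates the value of [A] by [k], which is the
    action defining the associated bundle. *)
Lemma bundle_mapE q0 q1 :
  bundle_map (pair_class a q0 q1) =
  oplus a (pr_base a q0) (pr_base a q1) q0 (A (q0, q1)) (erefl (pr_base a q0)).
Proof.
rewrite /bundle_map; apply: val_inj => /=.
have [k] := orbit_reprP (diag_action a) (q0, q1).
rewrite -/(pair_class a q0 q1).
case: (orbit_repr _) => r0 r1 /= [-> ->]; congr (_, _, _).
- by apply/orbit_projP; exists k.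
- by apply/orbit_projP; exists k.
- by apply/orbit_projP; exists k; rewrite A_equiv.
Qed.

Definition bundle_inv (z : set_type (fiber_sum a)) : pair_quot a :=
  let p := orbit_repr (set_val z).2 in
  let q1 := orbit_repr (set_val z).1.2 in
  pair_class a p.1 (a (p.2 * (A (p.1, q1))^-1)%g q1).

(** Replacing [q1] by [l q1] multiplies the inverse of [A] by [l^-1] on the right, and the two
    cancel. Moving [(q, g)] by [k] moves the whole pair by [k]. *)
Lemma bundle_invE (z : set_type (fiber_sum a)) q g q1 :
  (set_val z).2 = assoc_class a q g -> (set_val z).1.2 = pr_base a q1 ->
  bundle_inv z = pair_class a q (a (g * (A (q, q1))^-1)%g q1).
Proof.
move=> z2 z1; rewrite /bundle_inv z2 z1.
have [k] := orbit_reprP (assoc_action a) (q, g).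
rewrite -/(assoc_class a q g); case: (orbit_repr _) => r s /= [-> ->].
have [l] := orbit_reprP a q1; rewrite -/(pr_base a q1).
move: (orbit_repr _) => r1 ->; apply/orbit_projP; exists k.
rewrite /= /diag_act /= -!lactM A_equiv; congr (_, a _ _).
by rewrite !invgM invgK !mulgA !mulgVK.
Qed.

Lemma bundle_mapK : cancel bundle_map bundle_inv.
Proof.
move=> z; rewrite -(orbit_reprK z); case: (orbit_repr z) => q0 q1.
rewrite -/(pair_class a q0 q1) bundle_mapE (@bundle_invE _ q0 (A (q0, q1)) q1) //.
by rewrite mulgV lact1.
Qed.

Lemma bundle_sum_surj (z : set_type (fiber_sum a)) : exists q g q1,
  (set_val z).2 = assoc_class a q g /\ (set_val z).1 = (pr_base a q, pr_base a q1).
Proof.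
case: z => [[[x0 x1] k] zP] /=.
have x0E : x0 = pr_assoc k by have := set_mem zP.
exists (orbit_repr k).1, (orbit_repr k).2, (orbit_repr x1); split.
  by rewrite -[LHS](orbit_reprK k); case: (orbit_repr k).
by rewrite x0E; congr (_, _); rewrite /pr_base orbit_reprK.
Qed.

(** By equivariance in the second argument, [A] takes the value [g] on [q] and
    [g A(q, q1)^-1 q1]. *)
Lemma bundle_invK : cancel bundle_inv bundle_map.
Proof.
move=> z; have [q [g [q1 [z2 z1]]]] := bundle_sum_surj z.
rewrite (bundle_invE z2 (congr1 snd z1)) bundle_mapE; apply: val_inj => /=.
rewrite connection_actr mulgVK [RHS](surjective_pairing (set_val z)) z1 -z2.
congr (_, _, _); apply/orbit_projP.
by exists (g * (A (q, q1))^-1)^-1%g; rewrite -lactM mulVg lact1.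
Qed.

(** Both sides read the base point off the same representative [orbit_repr z], so they agree by
    computation. *)
Lemma pr_bundle_map : @pr_fiber _ _ a \o bundle_map = pr_pair a.
Proof. by apply/funext => z. Qed.

(** Take [q1] to be the endpoint of the lift: there [A] is 1, and only [g] is left to act. *)
Lemma bundle_inv_oplus (x0 x1 : base a) (q : Q) (g : G)
    (qx0 : pr_base a q = x0) r :
  is_hlift A x0 x1 q r ->
  bundle_inv (oplus a x0 x1 q g qx0) =
  orbit_proj (diag_action a) (comp_act a (1%g, g) r).
Proof.
case: r => r0 r1 [/= -> _ r1x1 Ar].
rewrite (@bundle_invE _ q g r1) ?Ar ?invg1 ?mulg1 //.
by rewrite /comp_act /= lact1.
Qed.

End DiscreteConnection.

Arguments bundle_map {G Q} a A z.
Arguments bundle_inv {G Q} a A z.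

(** * Smoothness of both maps *)

Section Smoothness.
Context {R : realType} {nQ nG nS nE nK nP : nat}.
Context {Q : topologicalType} (aQ : atlas R nQ Q) (hQ : is_manifold aQ).
Context {G : groupTopologicalType} (aG : atlas R nG G) (hG : is_lie_group aG).
Context (a : left_action G Q) (ha : smooth_action aG aQ a).
Context (aS : atlas R nS (base a)) (hS : quotient_manifold aQ aS).
Context (aE : atlas R nE (pair_quot a)).
Context (hE : quotient_manifold (prod_atlas aQ aQ) aE).
Context (aK : atlas R nK (assoc_bundle a)).
Context (hK : quotient_manifold (prod_atlas aQ aG) aK).
Context (aP : atlas R nP (set_type (fiber_sum a))).
Context (hP : embedded_submanifold (prod_atlas (prod_atlas aS aS) aK) aP).
Context (A : Q * Q -> G) (hA : discrete_connection a aQ aG A).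

Let sQ := manifold_smooth_atlas hQ.
Let sG : smooth_atlas aG.
Proof. by have [/manifold_smooth_atlas] := hG. Qed.
Let sS := manifold_smooth_atlas (proj1 hS).
Let sE := manifold_smooth_atlas (proj1 hE).
Let sK := manifold_smooth_atlas (proj1 hK).
Let sP := manifold_smooth_atlas (proj1 hP).
Let sQQ := prod_smooth_atlas sQ sQ.
Let sQG := prod_smooth_atlas sQ sG.
Let sSSK := prod_smooth_atlas (prod_smooth_atlas sS sS) sK.

Let sat m n (M N : topologicalType) (aM : atlas R m M) (aN : atlas R n N) f x :
  smooth_atlas aM -> smooth_atlas aN -> smooth_map aM aN f -> smooth_at aM aN f x.
Proof. by move=> [hM _ _] [hN _ _] /(smooth_mapP _ hM hN). Qed.

Let sat_comp m n p (M N P : topologicalType) (aM : atlas R m M)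
    (aN : atlas R n N) (aP' : atlas R p P) (f : M -> N) (g : N -> P) x :
  smooth_atlas aM -> smooth_atlas aN -> smooth_atlas aP' ->
  smooth_at aM aN f x -> smooth_map aN aP' g -> smooth_at aM aP' (g \o f) x.
Proof.
move=> sM sN sP' fs gs; have [hM _ _] := sM.
by apply: (smooth_at_comp hM sN fs); exact: sat.
Qed.

Lemma bundle_map_smooth : smooth_map aE aP (bundle_map a A).
Proof.
have [As Aeq _] := hA.
pose i : set_type (fiber_sum a) -> _ := set_val.
have incl_smooth z :
    smooth_at aE (prod_atlas (prod_atlas aS aS) aK) (i \o bundle_map a A) z.
  (* Pulled back to pairs of points, the map becomes an explicit formula in [A] and the
     projections. *)
  rewrite -(orbit_reprK z); apply: (submersion_descent sQQ sE (proj2 hE)).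
  have -> : (i \o bundle_map a A) \o orbit_proj (diag_action a) =
    fun p => ((pr_base a p.1, pr_base a p.2), assoc_class a p.1 (A p)).
    apply/funext => -[q0 q1] /=.
    by rewrite -/(pair_class a q0 q1) bundle_mapE.
  have s1 := smooth_at_fst aQ (orbit_repr z) sQ.
  have s2 := smooth_at_snd aQ (orbit_repr z) sQ.
  have prs := proj1 (proj2 hS).
  apply: smooth_at_pair; first apply: smooth_at_pair.
  - exact: (sat_comp sQQ sQ sS s1 prs).
  - exact: (sat_comp sQQ sQ sS s2 prs).
  - have sA := sat (orbit_repr z) sQQ sG As.
    have sqA := smooth_at_pair s1 sA.
    exact: (sat_comp sQQ sQG sK sqA (proj1 (proj2 hK))).
have bc : continuous (bundle_map a A).
  have ic : continuous (i \o bundle_map a A) by move=> z; exact: (proj1 (incl_smooth z)).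
  exact: continuous_into_set_type ic.
have [hEc _ _] := sE; have [hPc _ _] := sP.
apply/(smooth_mapP _ hEc hPc) => z.
by apply: (immersion_lift sE sP sSSK (proj2 hP) bc); exact: incl_smooth.
Qed.

Lemma bundle_inv_smooth : smooth_map aP aE (bundle_inv a A).
Proof.
have [As Aeq _] := hA; have [_ Gm Gv] := hG.
have [hEc _ _] := sE; have [hPc _ _] := sP.
apply/(smooth_mapP _ hPc hEc) => z0.
have [q0 [g0 [p0 [z2 z1]]]] := bundle_sum_surj z0.
(* [sk] supplies a smooth choice of [(q, g)] and [ss] one of [q1], in place of the representatives
   in [bundle_inv]. *)
have [sk [skx skK sks]] := submersion_section (q0, g0) sQG sK (proj2 hK).
have [ss [ssx ssK sss]] := submersion_section p0 sQ sS (proj2 hS).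
have sv := sat z0 sP sSSK (proj1 (proj2 hP)).
have sk0 : smooth_at aP (prod_atlas aQ aG) (fun z => sk (set_val z).2) z0.
  have s2 := smooth_at_comp hPc sSSK sv (smooth_at_snd _ _ sK).
  by apply: (smooth_at_comp hPc sK s2); rewrite /= z2.
have ss0 : smooth_at aP aQ (fun z => ss (set_val z).1.2) z0.
  have sSS := prod_smooth_atlas sS sS.
  have s1 := smooth_at_comp hPc sSSK sv (smooth_at_fst _ _ sSS).
  have s12 := smooth_at_comp hPc sSS s1 (smooth_at_snd _ _ sS).
  by apply: (smooth_at_comp hPc sS s12); rewrite /= z1.
have sq := smooth_at_comp hPc sQG sk0 (smooth_at_fst _ _ sQ).
have sg := smooth_at_comp hPc sQG sk0 (smooth_at_snd _ _ sG).
have sA := sat_comp sP sQQ sG (smooth_at_pair sq ss0) As.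
have sAV := sat_comp sP sG sG sA Gv.
have sGG := prod_smooth_atlas sG sG.
have sgA := sat_comp sP sGG sG (smooth_at_pair sg sAV) Gm.
have sGQ := prod_smooth_atlas sG sQ.
have sq1 := sat_comp sP sGQ sQ (smooth_at_pair sgA ss0) ha.
have := sat_comp sP sQQ sE (smooth_at_pair sq sq1) (proj1 (proj2 hE)).
(* The composite [[q, g A(q, q1)^-1 q1]] so obtained is smooth at [z0]. By [bundle_invE] it equals
   [bundle_inv] wherever [sk] and [ss] are sections, hence near [z0]. *)
apply: smooth_at_eq => //.
have [vc _] := sv.
have n2 : \forall z \near z0,
    orbit_proj (assoc_action a) (sk (set_val z).2) = (set_val z).2.
  have N : \forall w \near (set_val z0).2, orbit_proj (assoc_action a) (sk w) = w.
    by rewrite z2.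
  have vc2 : {for z0, continuous (fun z : set_type (fiber_sum a) => (set_val z).2)}.
    exact: (proj1 (smooth_at_comp hPc sSSK sv (smooth_at_snd _ _ sK))).
  exact: vc2 _ N.
have n1 : \forall z \near z0, orbit_proj a (ss (set_val z).1.2) = (set_val z).1.2.
  have N : \forall w \near (set_val z0).1.2, orbit_proj a (ss w) = w by rewrite z1.
  have sSS := prod_smooth_atlas sS sS.
  have s1 := smooth_at_comp hPc sSSK sv (smooth_at_fst _ _ sSS).
  have [vc1 _] := smooth_at_comp hPc sSS s1 (smooth_at_snd _ _ sS).
  exact: vc1 _ N.
near=> z.
have z2' : orbit_proj (assoc_action a) (sk (set_val z).2) = (set_val z).2 by near: z.
have z1' : orbit_proj a (ss (set_val z).1.2) = (set_val z).1.2 by near: z.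
rewrite (@bundle_invE _ _ a A Aeq z (sk (set_val z).2).1 (sk (set_val z).2).2
  (ss (set_val z).1.2)) //.
by rewrite -{1}z2' /assoc_class -surjective_pairing.
Unshelve. all: by end_near. Qed.

End Smoothness.

Theorem proposition4p13 (R : realType) (nQ nG nS nE nK nP : nat)
  (Q : topologicalType) (aQ : atlas R nQ Q) (hQ : is_manifold aQ)
  (G : groupTopologicalType) (aG : atlas R nG G) (hG : is_lie_group aG)
  (a : left_action G Q) (ha : smooth_action aG aQ a) (hfree : free_action a)
  (aS : atlas R nS (base a)) (hS : quotient_manifold aQ aS)
  (aE : atlas R nE (pair_quot a))
  (hE : quotient_manifold (prod_atlas aQ aQ) aE)
  (aK : atlas R nK (assoc_bundle a))
  (hK : quotient_manifold (prod_atlas aQ aG) aK)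
  (aP : atlas R nP (set_type (fiber_sum a)))
  (hP : embedded_submanifold (prod_atlas (prod_atlas aS aS) aK) aP)
  (A : Q * Q -> G) (hA : discrete_connection a aQ aG A) :
  exists (alpha : pair_quot a -> set_type (fiber_sum a))
         (beta : set_type (fiber_sum a) -> pair_quot a),
    [/\ forall q0 q1 : Q,
          alpha (pair_class a q0 q1) =
          oplus a (pr_base a q0) (pr_base a q1) q0 (A (q0, q1)) (erefl (pr_base a q0)),
        bundle_isomorphism aE aP (pr_pair a) (pr_fiber a) alpha beta &
        forall (x0 x1 : base a) (q : Q) (g : G) (qx0 : pr_base a q = x0),
          beta (oplus a x0 x1 q g qx0) =
          orbit_proj (diag_action a)
            (comp_act a (1%g, g) (hlift a A x0 x1 q))].
Proof.
have [_ Aeq _] := hA.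
exists (bundle_map a A), (bundle_inv a A); split.
- exact: bundle_mapE.
- split.
  + exact: (bundle_map_smooth hQ hG hS hE hK hP hA).
  + exact: (bundle_inv_smooth hQ hG ha hS hE hK hP hA).
  + exact: bundle_mapK.
  + exact: bundle_invK.
  + exact: pr_bundle_map.
- move=> x0 x1 q g qx0; apply: bundle_inv_oplus => //.
  by have [] := hliftP x1 hA qx0.
Qed.
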